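(* Let $X=\theta^*+Z$ with an arbitrary $\theta^*\in\mathbb{R}^n$ and $Z$ satisfying condition (M). Then there is a universal constant $C>0$ such that for all $k\in[n]$, $$\mathbb{E}\|\widehat{\theta}(\Theta_k^{\uparrow})-\theta^*\|^2\leq C\Big[\inf_{\theta\in\Theta_k^{\uparrow}}\|\theta-\theta^*\|^2 + \sigma^2 + \sigma^2k\log\log(16n/k)\,\mathbf{1}\{k\geq 2\}\Big].$$ In particular, for $k\ge 2$, $\sup_{\theta^*\in\Theta_k^\uparrow}\mathbb{E}\|\widehat{\theta}(\Theta_k^{\uparrow})-\theta^*\|^2\leq C\sigma^2k\log\log(16n/k)$.
   Context: $[n]=\{1,\dots,n\}$. For reals $a\le b$, $(a:b]$ is the set of integers $i$ with $a<i\le b$. $\|\cdot\|$ is the Euclidean norm. For $k\in[n]$, $\Theta_k^{\uparrow}$ is the set of $\theta\in\mathbb{R}^n$ for which there exist integers $0=a_0\le a_1\le\cdots\le a_k=n$ and reals $\mu_1\le\mu_2\le\cdots\le\mu_k$ with $\theta_i=\mu_j$ for all $i\in(a_{j-1}:a_j]$, $j\in[k]$ (nondecreasing vectors with at most $k$ constant pieces). $\widehat{\theta}(\Theta_k^{\uparrow})$ denotes a minimizer of $\|X-\theta\|^2$ over $\theta\in\Theta_k^{\uparrow}$ (reduced isotonic regression). Condition (M): $Z_1,\dots,Z_n$ are independent with mean zero and, for some $\sigma>0$, a fixed $\epsilon\in(0,1)$ and a fixed constant $C_1>0$, either (i) $\max_{1\le i\le n}\mathbb{E}|Z_i/\sigma|^{2+\epsilon}\le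 C_1$, or (ii) the $Z_i$ are identically distributed and $\mathbb{E}(Z_1^2/\sigma^2)\log(e+Z_1^2/\sigma^2)\le C_1$. ''Universal constants'' may depend only on $\epsilon$ and $C_1$. *)

(* Defs.v *)
From HB Require Import structures.
From mathcomp Require Import all_boot all_order all_algebra.
From mathcomp Require Import all_classical all_reals all_analysis.
Set Implicit Arguments. Unset Strict Implicit. Unset Printing Implicit Defensive.
Import Order.TTheory GRing.Theory Num.Theory.
Local Open Scope ring_scope.
Local Open Scope classical_set_scope.

(* Vectors in R^n are functions 'I_n -> R; coordinates are 0-based:
   the paper's coordinate i (1-based) is our coordinate i-1. *)

Definition sqnorm {R : realType} {n : nat} (x : 'I_n -> R) : R :=
  \sum_(i < n) (x i) ^+ 2.
Definition sqdist {R : realType} {n : nat} (x y : 'I_n -> R) : R :=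
  sqnorm (fun i => x i - y i).

(* Theta_k^up: nondecreasing vectors with at most k constant pieces.
   There exist integers 0 = a_0 <= a_1 <= ... <= a_k = n and reals
   mu_1 <= ... <= mu_k with theta_i = mu_j for all i in (a_{j-1} : a_j]
   (1-based i), i.e. for 0-based i with a_{j-1} <= i < a_j. *)
Definition Theta_up {R : realType} (n k : nat) (theta : 'I_n -> R) : Prop :=
  exists (a : nat -> nat) (mu : nat -> R),
    [/\ a 0%N = 0%N, a k = n,
        (forall j, (j < k)%N -> (a j <= a j.+1)%N),
        (forall j, (1 <= j)%N -> (j < k)%N -> mu j <= mu j.+1) &
        (forall j (i : 'I_n), (1 <= j <= k)%N ->
           (a j.-1 <= i)%N -> (i < a j)%N -> theta i = mu j)].

Definition is_reduced_isotonic_LSE {R : realType} (n k : nat)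
  (thetahat : ('I_n -> R) -> ('I_n -> R)) : Prop :=
  forall x, Theta_up k (thetahat x) /\
    (forall theta, Theta_up k theta -> sqdist x (thetahat x) <= sqdist x theta).

Definition mutually_independent {d} {T : measurableType d} {R : realType}
  (P : probability T R) (n : nat) (Z : 'I_n -> T -> R) : Prop :=
  forall A : 'I_n -> set R, (forall i, measurable (A i)) ->
    P [set w | forall i, A i (Z i w)] = (\prod_(i < n) P (Z i @^-1` A i))%E.

Definition condition_M {d} {T : measurableType d} {R : realType}
  (P : probability T R) (n : nat) (Z : 'I_n -> T -> R)
  (sigma eps C1 : R) : Prop :=
  [/\ (forall i, measurable_fun setT (Z i)),
      mutually_independent P Z,
      (forall i, P.-integrable setT (EFin \o Z i) /\ ('E_P[Z i] = 0)%E) &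
      ( (forall i, ('E_P[(fun w => `|Z i w / sigma| `^ (2 + eps))%R] <= C1%:E)%E)
      \/
        ((forall i j (A : set R), measurable A ->
            P (Z i @^-1` A) = P (Z j @^-1` A)) /\
         (forall i, ('E_P[(fun w => (Z i w ^+ 2 / sigma ^+ 2)
                        * ln (expR 1 + Z i w ^+ 2 / sigma ^+ 2))%R] <= C1%:E)%E)))].

(* Main.v *)
Require Import Defs.
From HB Require Import structures.
From mathcomp Require Import all_boot all_order all_algebra.
From mathcomp Require Import all_classical all_reals all_analysis.
From mathcomp Require Import measurable_realfun ring lra zify.
Set Implicit Arguments. Unset Strict Implicit. Unset Printing Implicit Defensive.
Import Order.TTheory GRing.Theory Num.Theory.
Local Open Scope ring_scope.
Local Open Scope classical_set_scope.

(** Let [D = thetahat - theta] for a competitor [theta] in [Theta_k]. The least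
squares property bounds the risk by [3 |theta - theta*|^2] plus a multiple of
[<Z, D>], up to [|D|^2 / 4], so it is enough to control [<Z, D>]. On every
constant piece of [theta] the vector [D] is nondecreasing, hence its positive
part is a nonnegative combination of indicators of intervals ending at the right
end of the piece, and its negative part of intervals starting at the left end.
Grouping these intervals by the dyadic scale [2^t] of their length, the
coefficients of one scale are absorbed by [|D|^2], and [<Z, D>] is controlled by
the sum of [Y_t = max_m S_m^2 / 2^t] over the scales in use, where [S_m] are the
partial sums of the noise from the end of the piece. At most [2 k] scales are in
use, because [thetahat] has at most [k] pieces, while there are only about
[k log(n/k)] pairs (piece, scale).

With [L = 2 log log (16 n / k)], each [Y_t] is compared to a level [A L]. The scales
in use cost [A L] each, and the expected excess [E (Y_t - A L)_+] is summed over all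
scales. For the latter, the noise is truncated at [X^2 <= 2^t / L]. The exponential
Doob inequality makes the excess of the truncated part [O(exp (-L))], which
compensates the number of scales. Doob's [L^2] inequality bounds the remainder by
[E X^2 1{X^2 > 2^t / L}], whose sum over [t] is [O(L)] under condition (M). *)

(** * Monotone vectors and partial sums at dyadic scales *)

(** The decrements of a nonincreasing [w] are nonnegative, so this form turns bounds on the partial
    sums of [z] into a bound on the inner product. *)
Lemma abel_summation (R : realType) (z w : nat -> R) (M : nat) :
  \sum_(i < M) z i * w i =
  \sum_(i < M) (\sum_(j < i.+1) z j) * (w i - w i.+1) + (\sum_(j < M) z j) * w M.
Proof.
elim: M => [|M IH]; first by rewrite !big_ord0 mul0r addr0.
rewrite big_ord_recr /= IH [in RHS]big_ord_recr /= [\sum_(j < M.+1) z j]big_ord_recr /=.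
by ring.
Qed.

Section Blocks.
Variables (R : realType) (w : nat -> R).
Hypothesis w_ge0 : forall i, 0 <= w i.
Hypothesis w_noninc : forall i j, (i <= j)%N -> w j <= w i.

(** Cauchy condensation: on the [2^T] indices from [2^T] to [2^(T+1) - 1], [w] is at least its value
    at the last one, so this block pays for half of the weight [2^(T+1)]. *)
Lemma sum_dyadic_le (T : nat) :
  \sum_(t < T.+1) 2 ^+ t * w (2 ^ t).-1 ^+ 2 <= 2 * \sum_(i < 2 ^ T) w i ^+ 2.
Proof.
elim: T => [|T IH].
  by rewrite expn0 !big_ord_recr !big_ord0 /= !add0r expr0 mul1r; have := sqr_ge0 (w 0%N); lra.
rewrite big_ord_recr /=.
have -> : (2 ^ T.+1 = 2 ^ T + 2 ^ T)%N by rewrite expnS mul2n addnn.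
rewrite big_split_ord /= mulrDr; apply: lerD => //.
have : \sum_(i < 2 ^ T) w (2 ^ T + 2 ^ T).-1 ^+ 2 <= \sum_(i < 2 ^ T) w (2 ^ T + i) ^+ 2.
  apply: ler_sum => i _; rewrite lerXn2r ?nnegrE //; apply: w_noninc.
  by have := ltn_ord i; lia.
rewrite sumr_const card_ord -[_ *+ _]mulr_natl natrX => h.
by rewrite exprS -mulrA; apply: ler_wpM2l.
Qed.

(** All indices of scale [t] are at least [2^t - 1]. Adding the remaining decrements beyond that
    point only enlarges the sum, which then telescopes. *)
Lemma block_jump_le (M t : nat) : (2 ^ t <= M)%N -> w M = 0 ->
  \sum_(i < M | trunc_log 2 i.+1 == t) (w i - w i.+1) <= w (2 ^ t).-1.
Proof.
move=> tM wM.
have hw i : 0 <= w i - w i.+1 by rewrite subr_ge0 w_noninc.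
apply: (@le_trans _ _ (\sum_(i < M | ((2 ^ t).-1 <= i)%N) (w i - w i.+1))).
  rewrite [leLHS]big_mkcond [leRHS]big_mkcond /=; apply: ler_sum => i _.
  case: eqP => [e|_]; last by case: ifP.
  by rewrite ifT //; have := @trunc_logP 2 i.+1 isT isT; rewrite e; lia.
have e0 : (0 < 2 ^ t)%N by rewrite expn_gt0.
rewrite -(big_mkord (fun i => ((2 ^ t).-1 <= i)%N) (fun i => w i - w i.+1)).
rewrite (@big_cat_nat _ _ _ (2 ^ t).-1) //=; last by lia.
rewrite [X in X + _]big_nat_cond [X in X + _]big1 ?add0r; last by move=> i; lia.
rewrite big_nat_cond (eq_bigl (fun i => ((2 ^ t).-1 <= i < M)%N && true)) -?big_nat_cond; last first.
  by move=> i; lia.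
rewrite (eq_bigr (fun i => (- w i.+1) - (- w i))); last by move=> i _; ring.
rewrite telescope_sumr ?wM; [by lra | by lia].
Qed.

End Blocks.

(** After Abel summation the coefficients, which are the decrements of [w], are grouped by dyadic
    scale. A scale without a strict decrease costs nothing; any other costs a multiple of [B], a
    multiple of the excess of [Y t] over [B], and a share of the squared norm of [w]. *)
Lemma monotone_inner_le_full (R : realType) (z w Y : nat -> R) (M : nat) (B : R) :
  0 <= B -> (forall i, 0 <= w i) -> (forall i j, (i <= j)%N -> w j <= w i) ->
  (forall i, (M <= i)%N -> w i = 0) ->
  (forall m, (m < M)%N -> (\sum_(i < m.+1) z i) ^+ 2
      <= 2 ^+ trunc_log 2 m.+1 * Y (trunc_log 2 m.+1)) ->
  \sum_(i < M) z i * w i <= 8^-1 * \sum_(i < M) w i ^+ 2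
    + 4 * B * (\sum_(i < M) (w i.+1 < w i)%R)%:R
    + 4 * \sum_(t < (trunc_log 2 M).+1) Num.max (Y t - B) 0.
Proof.
move=> B0 w0 wni wM hY.
have [->|M0] := eqVneq M 0%N.
  rewrite !big_ord0 /= mulr0n !mulr0 !add0r; apply: mulr_ge0 => //.
  by apply: sumr_ge0 => t _; rewrite le_max lexx orbT.
have {}M0 : (0 < M)%N by rewrite lt0n.
set TL := trunc_log 2 M.
have tlM (i : 'I_M) : (trunc_log 2 i.+1 < TL.+1)%N.
  by rewrite ltnS; apply: leq_trunc_log; exact: ltn_ord.
pose h i := w i - w i.+1.
have h0 i : 0 <= h i by rewrite subr_ge0 wni.
pose H (t : nat) := \sum_(i < M | trunc_log 2 i.+1 == t) h i.
pose act (t : nat) := [exists i : 'I_M, (trunc_log 2 i.+1 == t) && (0 < h i)].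
have H0 t : 0 <= H t by apply: sumr_ge0 => i _.
have YM (i : 'I_M) : 0 <= Y (trunc_log 2 i.+1).
  have := hY i (ltn_ord i) => /(le_trans (sqr_ge0 _)).
  by rewrite pmulr_rge0 // exprn_gt0.
have step1 : \sum_(i < M) z i * w i <= \sum_(t < TL.+1) H t * Num.sqrt (2 ^+ t * Y t).
  rewrite abel_summation wM // mulr0 addr0.
  rewrite /H; under [leRHS]eq_bigr do rewrite mulr_suml.
  rewrite (exchange_big_dep predT) //=; apply: ler_sum => i _.
  rewrite (big_pred1 (Ordinal (tlM i))) /=; last by move=> t; rewrite /= -val_eqE /= eq_sym.
  rewrite mulrC; apply: ler_wpM2l; first exact: h0.
  apply: (le_trans (ler_norm _)); rewrite -sqrtr_sqr.
  by apply: ler_wsqrtr; exact: hY.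
(* On an active scale this is [x y <= x^2 / 16 + 4 y^2] with [x = H t * sqrt (2^t)] and
   [y = sqrt (Y t)]. On an inactive scale [H t = 0], so [B] is not charged. *)
have step2 (t : 'I_TL.+1) : H t * Num.sqrt (2 ^+ t * Y t) <=
    16^-1 * (2 ^+ t * w (2 ^ t).-1 ^+ 2) + 4 * B * (act t)%:R + 4 * Num.max (Y t - B) 0.
  have mx0 : 0 <= Num.max (Y t - B) 0 by rewrite le_max lexx orbT.
  have mx1 : Y t - B <= Num.max (Y t - B) 0 by rewrite le_max lexx.
  have p0 : 0 <= 2 ^+ t * w (2 ^ t).-1 ^+ 2 by rewrite mulr_ge0 // ?exprn_ge0 // sqr_ge0.
  case: (boolP (act t)) => [/existsP[i /andP[/eqP it hi]]|nact].
    have Yt : 0 <= Y t by rewrite -it.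
    have t2 : (2 ^ t <= M)%N.
      by rewrite -it (leq_trans (@trunc_logP 2 i.+1 isT isT)).
    have Hw : H t ^+ 2 <= w (2 ^ t).-1 ^+ 2.
      by rewrite lerXn2r ?nnegrE //; apply: block_jump_le => //; apply: wM.
    have e2 : 0 <= 2 ^+ t :> R by rewrite exprn_ge0.
    rewrite sqrtrM //.
    set a := Num.sqrt (2 ^+ t : R); set b := Num.sqrt (Y t).
    have ea : a ^+ 2 = 2 ^+ t by rewrite sqr_sqrtr.
    have eb : b ^+ 2 = Y t by rewrite sqr_sqrtr.
    have := sqr_ge0 (H t * a / 4 - 2 * b).
    have : 2 ^+ t * H t ^+ 2 <= 2 ^+ t * w (2 ^ t).-1 ^+ 2 by apply: ler_wpM2l.
    rewrite -ea -eb /= mulr1n in mx1 *. nra.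
  have -> : H t = 0.
    apply: big1 => i it; apply/eqP; rewrite eq_le h0 andbT leNgt; apply/negP => hi.
    by move/existsP: nact; apply; exists i; rewrite it.
  by rewrite mul0r /= mulr0n mulr0 addr0; lra.
(* Each active scale contains a strict decrease, and each index belongs to a single scale. *)
have act_le : (\sum_(t < TL.+1) act t <= \sum_(i < M) (w i.+1 < w i)%R)%N.
  apply: (@leq_trans (\sum_(t < TL.+1) \sum_(i < M | trunc_log 2 i.+1 == t) (w i.+1 < w i)%R)).
    apply: leq_sum => t _; case: (boolP (act t)) => // /existsP[i /andP[it hi]].
    by rewrite (bigD1 i) //= -subr_gt0 hi.
  rewrite (exchange_big_dep predT) //=; apply: leq_sum => i _.
  by rewrite (big_pred1 (Ordinal (tlM i))) //= => t; rewrite /= -val_eqE /= eq_sym.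
apply: (le_trans step1); apply: (le_trans (ler_sum _ (fun t _ => step2 t))).
rewrite !big_split /= -!mulr_sumr; apply: lerD => //; apply: lerD.
  (* Condensation loses a factor [2], which turns [1/16] into [1/8]. *)
  have := sum_dyadic_le w0 wni TL.
  have : \sum_(i < 2 ^ TL) w i ^+ 2 <= \sum_(i < M) w i ^+ 2.
    rewrite -!(big_mkord xpredT (fun i => w i ^+ 2)).
    rewrite (@big_cat_nat _ _ _ (2 ^ TL) 0 M) //=; last exact: trunc_logP.
    by rewrite lerDl sumr_ge0 // => i _; exact: sqr_ge0.
  lra.
rewrite -natr_sum; apply: ler_wpM2l; first by rewrite mulr_ge0.
by rewrite ler_nat.
Qed.

(** Here [w] is constrained only below [M]. It is continued by zero, and the drop to zero after
    index [M - 1] is the extra unit in the jump count. *)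
Lemma monotone_inner_le (R : realType) (z w Y : nat -> R) (M : nat) (B : R) :
  0 <= B -> (forall i, (i < M)%N -> 0 <= w i) ->
  (forall i j, (i <= j)%N -> (j < M)%N -> w j <= w i) ->
  (forall m, (m < M)%N -> (\sum_(i < m.+1) z i) ^+ 2
      <= 2 ^+ trunc_log 2 m.+1 * Y (trunc_log 2 m.+1)) ->
  \sum_(i < M) z i * w i <= 8^-1 * \sum_(i < M) w i ^+ 2
    + 4 * B * (1 + \sum_(i < M.-1) (w i.+1 < w i)%R)%:R
    + 4 * \sum_(t < (trunc_log 2 M).+1) Num.max (Y t - B) 0.
Proof.
move=> B0 w0 wni hY.
pose w' i := if (i < M)%N then w i else 0.
have w'E (i : 'I_M) : w' i = w i by rewrite /w' ltn_ord.
have := @monotone_inner_le_full R z w' Y M B B0 _ _ _ hY.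
under eq_bigr do rewrite w'E. under [X in 8^-1 * X]eq_bigr do rewrite w'E.
move=> H; apply: (le_trans (H _ _ _)).
- by rewrite /w' => i; case: ltnP => // /w0.
- rewrite /w' => i j ij; case: ltnP => jM; first by rewrite (leq_ltn_trans ij jM) wni.
  by case: ltnP => // /w0.
- by rewrite /w' => i; rewrite ltnNge => ->.
- rewrite lerD2r lerD2l; apply: ler_wpM2l; first by rewrite mulr_ge0.
  rewrite ler_nat; case: (M) @w' w'E {H} => [|m] w' w'E; first by rewrite !big_ord0.
  rewrite big_ord_recr /= addnC leq_add //; first by case: (_ < _).
  by apply: leq_sum => i _; rewrite /w' !ltnS ltn_ord (ltnW (ltn_ord i)).
Qed.

(** * Decomposition into constant pieces *)

Section Pieces.
Variables (a : nat -> nat) (k : nat).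
Hypothesis a0 : a 0%N = 0%N.
Hypothesis aS : forall j, (j < k)%N -> (a j <= a j.+1)%N.

Lemma pieces_mono i j : (i <= j <= k)%N -> (a i <= a j)%N.
Proof.
move=> /andP[]; elim: j => [|j IH]; first by rewrite leqn0 => /eqP ->.
rewrite leq_eqVlt => /orP[/eqP -> //|ij] jk.
by rewrite (leq_trans (IH _ (ltnW jk))) // aS.
Qed.

Lemma piece_exists j i : (j <= k)%N -> (i < a j)%N ->
  exists2 l, (l < j)%N & (a l <= i < a l.+1)%N.
Proof.
elim: j => [|j IH] jk; first by rewrite a0.
case: (ltnP i (a j)) => [/(IH (ltnW jk))[l lj h] _|h1 h2]; first by exists l => //; exact: ltnW.
by exists j => //; rewrite h1.
Qed.

Lemma sum_pieces (V : nmodType) (F : nat -> V) :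
  \sum_(i < a k) F i = \sum_(j < k) \sum_(m < a j.+1 - a j) F (a j + m)%N.
Proof.
suff h j : (j <= k)%N -> \sum_(i < a j) F i =
    \sum_(l < j) \sum_(m < a l.+1 - a l) F (a l + m)%N by exact: h.
elim: j => [|j IH] jk; first by rewrite a0 !big_ord0.
rewrite big_ord_recr /= -IH ?(ltnW jk) //.
have e : a j.+1 = (a j + (a j.+1 - a j))%N by rewrite subnKC // aS.
by rewrite [in LHS]e big_split_ord.
Qed.

End Pieces.

Lemma sum_rev (V : nmodType) (F : nat -> V) (M : nat) :
  \sum_(m < M) F m = \sum_(m < M) F (M - m.+1)%N.
Proof. by rewrite (reindex_inj rev_ord_inj). Qed.

Section MonotonePieces.
Variables (R : realType) (z D : nat -> R) (a : nat -> nat) (k : nat) (B : R).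
Variables (J : nat -> bool) (Yl Yr : nat -> nat -> R).
Hypothesis B0 : 0 <= B.
Hypothesis a0 : a 0%N = 0%N.
Hypothesis aS : forall j, (j < k)%N -> (a j <= a j.+1)%N.
Hypothesis D_mono : forall j i i', (j < k)%N -> (a j <= i <= i')%N -> (i' < a j.+1)%N ->
  D i <= D i'.
Hypothesis D_jump : forall j i, (j < k)%N -> (a j <= i)%N -> (i.+1 < a j.+1)%N ->
  D i < D i.+1 -> J i.
Hypothesis J_le : (\sum_(i < a k) J i <= k)%N.
Hypothesis Yl_ge : forall j m, (j < k)%N -> (m < a j.+1 - a j)%N ->
  (\sum_(i < m.+1) z (a j + i)) ^+ 2 <= 2 ^+ trunc_log 2 m.+1 * Yl j (trunc_log 2 m.+1).
Hypothesis Yr_ge : forall j m, (j < k)%N -> (m < a j.+1 - a j)%N ->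
  (\sum_(i < m.+1) z (a j.+1 - i.+1)) ^+ 2 <= 2 ^+ trunc_log 2 m.+1 * Yr j (trunc_log 2 m.+1).

Let len j := (a j.+1 - a j)%N.
Let npart i := Num.max (- D i) 0.
Let ppart i := Num.max (D i) 0.

Let splitD i : D i = ppart i - npart i /\ D i ^+ 2 = ppart i ^+ 2 + npart i ^+ 2.
Proof.
rewrite /ppart /npart; have [h|/ltW h] := leP 0 (D i).
  have -> : Num.max (- D i) 0 = 0 by apply: max_r; rewrite oppr_le0.
  by split; ring.
have -> : Num.max (- D i) 0 = - D i by apply: max_l; rewrite oppr_ge0.
by split; ring.
Qed.

Let jumps j := (\sum_(m < (len j)) J (a j + m))%N.

(** On a piece the negative part of [D] is nonincreasing from the left end, so the noise is summed
    from there. A strict decrease of it is a strict increase of [D], which [J] flags. *)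
Lemma left_piece_le j : (j < k)%N ->
  \sum_(m < len j) - z (a j + m)%N * npart (a j + m) <=
  8^-1 * \sum_(m < len j) npart (a j + m) ^+ 2 + 4 * B * (1 + jumps j)%:R
  + 4 * \sum_(t < (trunc_log 2 (len j)).+1) Num.max (Yl j t - B) 0.
Proof.
move=> jk; have := aS jk => ajS.
apply: (le_trans (@monotone_inner_le R (fun m => - z (a j + m)%N)
   (fun m => npart (a j + m)%N) (Yl j) (len j) B B0 _ _ _)).
- by move=> i _; rewrite /npart le_max lexx orbT.
- move=> i i' ii' i'M; rewrite /npart ge_max !le_max lexx orbT andbT lerN2.
  by rewrite (@D_mono j) //; move: i'M; rewrite /len; lia.
- by move=> m mM; rewrite sumrN sqrrN; exact: Yl_ge.
- rewrite lerD2r lerD2l; apply: ler_wpM2l; first by rewrite mulr_ge0.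
  rewrite ler_nat leq_add2l /jumps; case e : (len j) => [|M]; first by rewrite !big_ord0.
  rewrite [X in (_ <= X)%N]big_ord_recr /= -[X in (X <= _)%N]addn0 leq_add //.
  apply: leq_sum => m _; case: ltP => // h; rewrite lt0b.
  apply: (@D_jump j) => //; first by lia.
    by have := ltn_ord m; move: e; rewrite /len; lia.
  by move: h; rewrite addnS /npart /Num.max; do 2![case: ifP]; lra.
Qed.

(** Mirror image: read from the right end, the positive part of [D] is nonincreasing. *)
Lemma right_piece_le j : (j < k)%N ->
  \sum_(m < len j) z (a j + m)%N * ppart (a j + m) <=
  8^-1 * \sum_(m < len j) ppart (a j + m) ^+ 2 + 4 * B * (1 + jumps j)%:R
  + 4 * \sum_(t < (trunc_log 2 (len j)).+1) Num.max (Yr j t - B) 0.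
Proof.
move=> jk; have := aS jk => ajS.
have rev m : (m < len j)%N -> (a j + (len j - m.+1) = a j.+1 - m.+1)%N.
  by rewrite /len; lia.
rewrite (sum_rev (fun m => z (a j + m)%N * ppart (a j + m)%N)).
rewrite (sum_rev (fun m => ppart (a j + m)%N ^+ 2)).
under eq_bigr do rewrite rev //. under [X in 8^-1 * X]eq_bigr do rewrite rev //.
apply: (le_trans (@monotone_inner_le R (fun m => z (a j.+1 - m.+1)%N)
   (fun m => ppart (a j.+1 - m.+1)%N) (Yr j) (len j) B B0 _ _ _)).
- by move=> i _; rewrite /ppart le_max lexx orbT.
- move=> i i' ii' i'M; rewrite /ppart ge_max !le_max lexx orbT andbT.
  by rewrite (@D_mono j) //; move: i'M; rewrite /len; lia.
- by move=> m mM; exact: Yr_ge.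
- rewrite lerD2r lerD2l; apply: ler_wpM2l; first by rewrite mulr_ge0.
  rewrite ler_nat leq_add2l /jumps; case e : (len j) => [|M]; first by rewrite !big_ord0.
  rewrite [X in (_ <= X)%N]big_ord_recr /= -[X in (X <= _)%N]addn0 leq_add //.
  rewrite (sum_rev (V := nat) (fun m => J (a j + m)%N : nat)).
  apply: leq_sum => m _; case: ltP => // h; rewrite lt0b.
  have e' : (a j.+1 - m.+2 = a j + (M - m.+1))%N.
    by have := ltn_ord m; move: e; rewrite /len; lia.
  have e'' : (a j.+1 - m.+1 = (a j + (M - m.+1)).+1)%N.
    by have := ltn_ord m; move: e; rewrite /len; lia.
  apply: (@D_jump j) => //; first by lia.
    by have := ltn_ord m; move: e; rewrite /len; lia.
  by move: h; rewrite e' e'' /ppart /Num.max; do 2![case: ifP]; lra.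
Qed.

(** The two parts of [D] have disjoint supports, so their squares add up to [D^2]. Each sign is
    charged [4 B] times one unit per piece plus the flagged jumps, at most [2 k] units in all. *)
Lemma monotone_pieces_inner_le :
  \sum_(i < a k) z i * D i <= 8^-1 * \sum_(i < a k) D i ^+ 2 + 16 * B * k%:R
  + 4 * \sum_(j < k) \sum_(t < (trunc_log 2 (len j)).+1)
      (Num.max (Yl j t - B) 0 + Num.max (Yr j t - B) 0).
Proof.
have jl : (\sum_(j < k) (1 + jumps j) <= 2 * k)%N.
  rewrite big_split /= sum1_card card_ord mul2n -addnn leq_add2l.
  by rewrite -(sum_pieces (V := nat) a0 aS (fun i => J i : nat)).
have jl' : \sum_(j < k) (1 + jumps j)%:R <= 2 * k%:R :> R.
  by rewrite -natr_sum -natrM ler_nat.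
rewrite (sum_pieces a0 aS (fun i => z i * D i)) (sum_pieces a0 aS (fun i => D i ^+ 2)).
have e1 : \sum_(j < k) \sum_(m < len j) z (a j + m)%N * D (a j + m)%N =
    \sum_(j < k) \sum_(m < len j) z (a j + m)%N * ppart (a j + m)%N +
    \sum_(j < k) \sum_(m < len j) - z (a j + m)%N * npart (a j + m)%N.
  rewrite -big_split; apply: eq_bigr => j _; rewrite -big_split; apply: eq_bigr => m _ /=.
  by have [-> _] := splitD (a j + m); ring.
have e2 : \sum_(j < k) \sum_(m < len j) D (a j + m)%N ^+ 2 =
    \sum_(j < k) \sum_(m < len j) ppart (a j + m)%N ^+ 2 +
    \sum_(j < k) \sum_(m < len j) npart (a j + m)%N ^+ 2.
  rewrite -big_split; apply: eq_bigr => j _; rewrite -big_split; apply: eq_bigr => m _ /=.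
  by have [_ ->] := splitD (a j + m).
rewrite e1 e2.
have hl := ler_sum (P := xpredT) (index_enum 'I_k) (fun j _ => left_piece_le (ltn_ord j)).
have hr := ler_sum (P := xpredT) (index_enum 'I_k) (fun j _ => right_piece_le (ltn_ord j)).
apply: (le_trans (lerD hr hl)); rewrite !big_split /= -!mulr_sumr.
under [X in _ <= _ + 4 * X]eq_bigr do rewrite big_split /=.
rewrite [X in _ <= _ + 4 * X]big_split /=.
have : 4 * B * \sum_(j < k) (1 + jumps j)%:R <= 4 * B * (2 * k%:R).
  by apply: ler_wpM2l => //; rewrite mulr_ge0.
lra.
Qed.

End MonotonePieces.

(** * Independent sequences *)

Section ProductRule.
Context (d : measure_display) (T : measurableType d) (R : realType) (P : probability T R).
Variables (U V : {mfun T >-> R}).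
Hypothesis UV_indep : forall A B, measurable A -> measurable B ->
  P (U @^-1` A `&` V @^-1` B) = (P (U @^-1` A) * P (V @^-1` B))%E.
Hypothesis intU : P.-integrable setT (EFin \o U).
Hypothesis intV : P.-integrable setT (EFin \o V).

Let m1 := distribution P U.
Let m2 := distribution P V.

Let mUV : measurable_fun setT (fun w => (U w, V w)).
Proof. exact: measurable_fun_pair. Qed.

Let UV : {mfun T >-> (R * R)%type} :=
  HB.pack (fun w => (U w, V w)) (@isMeasurableFun.Build _ _ _ _ _ mUV).

Let g (z : R * R) : R := z.1 * z.2.
Let f := EFin \o g.

Let mf : measurable_fun setT f.
Proof. by apply/measurable_EFinP; apply: measurable_funM. Qed.

Let joint_law A : measurable A ->
  (m1 \x m2)%E A = distribution P UV A.
Proof.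
by move=> mA; apply: product_measure_unique => // B C mB mC; exact: UV_indep.
Qed.

(** By Tonelli the double integral of [|x y|] factors into the two absolute first moments, both
    finite. *)
Let intf : (m1 \x m2)%E.-integrable setT f.
Proof.
apply/(integrable12ltyP _ _ mf).
have mabs : measurable_fun setT (fun y : R => `|y%:E|%E).
  by apply: (measurableT_comp (f := abse)) => //; exact: EFin_measurable.
have -> : (\int[m1]_x \int[m2]_y `|f (x, y)| =
    \int[m1]_x (`|(x : R)%:E| * \int[P]_w `|(V w)%:E|))%E.
  apply: eq_integral => /= x _.
  rewrite (eq_integral (fun y : R => `|x%:E| * `|y%:E|)%E); last by move=> y _; rewrite /f /= normrM.
  rewrite ge0_integralZl //.
  by rewrite /m2 (@ge0_integral_distribution _ _ _ _ _ P V (fun y : R => `|y%:E|%E)).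
have /integrableP[_ V1] := intV; have /integrableP[_ U1] := intU.
rewrite ge0_integralZr //; last by apply: integral_ge0 => w _; exact: abse_ge0.
rewrite /m1 (@ge0_integral_distribution _ _ _ _ _ P U (fun y : R => `|y%:E|%E)) //.
have i0 (W : T -> R) : (0 <= \int[P]_w `|(W w)%:E|)%E.
  by apply: integral_ge0 => w _; exact: abse_ge0.
apply: lte_mul_pinfty; [exact: i0| |exact: V1].
by rewrite ge0_fin_numE //; exact: i0.
Qed.

Lemma indep_integrableM : P.-integrable setT (EFin \o (fun w => U w * V w)).
Proof.
apply/integrableP; split; first by apply/measurable_EFinP; apply: measurable_funM.
have /integrableP[_] := intf.
rewrite (eq_measure_integral (distribution P UV)); last first.
  by move=> A mA _; exact: joint_law.
by rewrite ge0_integral_distribution //; apply: measurableT_comp.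
Qed.

Lemma indep_expectationM :
  \int[P]_w (U w * V w) = \int[P]_w U w * \int[P]_w V w.
Proof.
have e : (\int[P]_w (U w * V w)%:E = \int[m1 \x m2]_z f z)%E.
  rewrite (eq_measure_integral (distribution P UV)); last first.
    by move=> A mA _; exact: joint_law.
  by rewrite integral_distribution //; exact: indep_integrableM.
have eV : (\int[P]_w (V w)%:E = (\int[P]_w V w)%:E)%E.
  by rewrite fineK //; exact: integrable_fin_num.
have iid2 : m2.-integrable setT (EFin \o @idfun R).
  by apply: integrable_pushforward => //; exact: EFin_measurable.
have iid : m1.-integrable setT (EFin \o @idfun R).
  by apply: integrable_pushforward => //; exact: EFin_measurable.
rewrite /Rintegral -fineM; [|exact: integrable_fin_num..].
congr fine; rewrite e -integral12_prod_meas1 //.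
rewrite (eq_integral (fun x : R => x%:E * \int[P]_w (V w)%:E)%E); last first.
  move=> x _; transitivity (\int[m2]_y (x%:E * (y : R)%:E))%E.
    by apply: eq_integral => y _.
  rewrite [LHS](integralZl measurableT iid2 x); congr (_ * _)%E.
  by rewrite /m2 (@integral_distribution _ _ _ _ _ P V EFin).
rewrite eV [LHS](integralZr measurableT iid); congr (_ * _)%E.
by rewrite /m1 (@integral_distribution _ _ _ _ _ P U EFin).
Qed.

End ProductRule.

Section IndependentSequence.
Context (d : measure_display) (T : measurableType d) (R : realType) (P : probability T R).

(** Independence of the first [M] terms only. Indexing by [nat] allows partial sums and inductions
    on the number of terms, with arbitrary values from [M] on. *)
Definition indep_seq (M : nat) (X : nat -> T -> R) : Prop :=
  forall A : nat -> set R, (forall i, measurable (A i)) ->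
    P [set w | forall i, (i < M)%N -> A i (X i w)] = (\prod_(i < M) P (X i @^-1` A i))%E.

Lemma indep_seqS M X : indep_seq M.+1 X -> indep_seq M X.
Proof.
move=> h A mA; pose A' i := if (i < M)%N then A i else setT.
have mA' i : measurable (A' i) by rewrite /A'; case: ifP.
have := h A' mA'; rewrite big_ord_recr /= /A' ltnn preimage_setT probability_setT mule1.
under eq_bigr do rewrite ltn_ord.
move=> <-; congr (P _); apply/seteqP; split=> w /= H i iM; last first.
  by have := H i (ltnW iM); rewrite iM.
by case: ifP => // /H.
Qed.

Lemma indep_seq_le M N X : (N <= M)%N -> indep_seq M X -> indep_seq N X.
Proof.
move=> /subnK <-; elim: (M - N)%N => // k IH h; apply: IH; exact: indep_seqS.
Qed.

Lemma indep_seq_comp M X (phi : nat -> R -> R) :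
  (forall i, measurable_fun setT (phi i)) -> indep_seq M X ->
  indep_seq M (fun i w => phi i (X i w)).
Proof.
move=> mphi h A mA.
rewrite (h (fun i => phi i @^-1` A i)) // => i.
by rewrite -[X in measurable X]setTI; exact: mphi.
Qed.

(** A family stable under intersection that generates the sigma-algebra of the variables of index
    below [j]. *)
Definition past_cylinder (X : nat -> T -> R) (j : nat) : set (set T) :=
  [set B | exists2 A : nat -> set R, (forall i, measurable (A i)) &
     B = [set w | forall i, (i < j)%N -> A i (X i w)]].

(** Adaptedness: [U] is measurable for the sigma-algebra of the past of [j], which is put on the
    domain as a type so that the usual measurability lemmas apply. *)
Definition past_measurable (X : nat -> T -> R) (j : nat) (U : T -> R) : Prop :=
  measurable_fun (setT : set (g_sigma_algebraType (past_cylinder X j)))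
    (U : g_sigma_algebraType (past_cylinder X j) -> R).

Section Past.
Variables (X : nat -> T -> R) (M j : nat).
Hypothesis mX : forall i, measurable_fun setT (X i).
Hypothesis iX : indep_seq M X.
Hypothesis jM : (j < M)%N.

Lemma past_cylinder_measurable : past_cylinder X j `<=` measurable.
Proof.
move=> _ [A mA ->].
rewrite (_ : [set _ | _] = \bigcap_(i < j) (X i @^-1` A i)); last first.
  by apply/seteqP; split.
by apply: bigcap_measurableType => i _; rewrite -[X in measurable X]setTI; exact: mX.
Qed.

Lemma past_measurableW U : past_measurable X j U -> measurable_fun setT U.
Proof.
move=> mU _ B mB; have := mU measurableT B mB.
exact: (smallest_sub (@sigma_algebra_measurable _ T) past_cylinder_measurable).
Qed.

Lemma past_measurableX i : (i < j)%N -> past_measurable X j (X i).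
Proof.
move=> ij _ B mB; rewrite setTI; apply: sub_sigma_algebra.
exists (fun k => if k == i then B else setT); first by move=> k; case: ifP.
apply/seteqP; split=> w /= H; last by have := H i ij; rewrite eqxx.
by move=> k kj; case: eqP => // ->.
Qed.

(** For fixed [B] both sides are finite measures in [E]. They agree on cylinders by independence,
    and the cylinders are stable under intersection, so uniqueness of measures extends the equality
    to the whole past. *)
Lemma indep_past_cylinder E B : <<s past_cylinder X j >> E -> measurable B ->
  P (E `&` X j @^-1` B) = (P E * P (X j @^-1` B))%E.
Proof.
move=> sE mB.
have mXB : measurable (X j @^-1` B) by rewrite -[X in measurable X]setTI; exact: mX.
have p0 : 0 <= fine (P (X j @^-1` B)) by rewrite fine_ge0.
pose p := NngNum p0.
have -> : (P E * P (X j @^-1` B) = mscale p P E)%E.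
  by rewrite /mscale /= muleC fineK // fin_num_measure.
rewrite -[LHS]/(mrestr P mXB E).
apply: (g_sigma_algebra_measure_unique (past_cylinder X j)
  past_cylinder_measurable (fun=> setT)) => //.
- move=> _; exists (fun=> setT) => //.
  by apply/seteqP; split.
- by rewrite bigcup_const.
- move=> _ _ [A mA ->] [A' mA' ->]; exists (fun i => A i `&` A' i).
    by move=> i; exact: measurableI.
  apply/seteqP; split=> w /=; first by move=> [h h'] i ij; split; [exact: h|exact: h'].
  by move=> h; split=> i /h [].
- move=> _ [A mA ->].
  (* Putting [B] at coordinate [j] makes the intersection a cylinder of the first [j + 1]
     variables. *)
  pose A' i := if (i < j)%N then A i else B.
  have mA' i : measurable (A' i) by rewrite /A'; case: ifP.
  have := indep_seq_le jM iX mA'; rewrite big_ord_recr /= /A' ltnn.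
  under [X in (_ = X * _)%E -> _]eq_bigr do rewrite ltn_ord.
  rewrite -(indep_seq_le (ltnW jM) iX mA) => h.
  rewrite /= /mrestr /mscale /= fineK ?fin_num_measure // muleC -h.
  congr (P _); apply/seteqP; split=> w /=.
    move=> [h1 h2] i; rewrite ltnS leq_eqVlt => /orP[/eqP ->|ij]; first by rewrite ltnn.
    by rewrite ij; exact: h1.
  move=> h1; split; last by have := h1 j (ltnSn j); rewrite ltnn.
  by move=> i ij; have := h1 i (ltnW ij); rewrite ij.
- by move=> k; rewrite (le_lt_trans (probability_le1 _ _)) ?ltry //; exact: measurableI.
Qed.

(** This replaces conditional expectation in the martingale arguments: against a past variable,
    [phi (X j)] acts through its mean alone. *)
Lemma indep_pastM U (phi : R -> R) : past_measurable X j U -> measurable_fun setT phi ->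
  P.-integrable setT (EFin \o U) -> P.-integrable setT (EFin \o (phi \o X j)) ->
  P.-integrable setT (EFin \o (fun w => U w * phi (X j w))) /\
  \int[P]_w (U w * phi (X j w)) = \int[P]_w U w * \int[P]_w phi (X j w).
Proof.
move=> mU mphi iU iV.
have mphiX : measurable_fun setT (phi \o X j) by exact: measurableT_comp.
pose U' : {mfun T >-> R} :=
  HB.pack U (@isMeasurableFun.Build _ _ _ _ U (past_measurableW mU)).
pose V' : {mfun T >-> R} :=
  HB.pack (phi \o X j) (@isMeasurableFun.Build _ _ _ _ (phi \o X j) mphiX).
have ind A B : measurable A -> measurable B ->
    P (U' @^-1` A `&` V' @^-1` B) = (P (U' @^-1` A) * P (V' @^-1` B))%E.
  move=> mA mB; rewrite /V' /= comp_preimage; apply: indep_past_cylinder; last first.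
    by rewrite -[X in measurable X]setTI; exact: mphi.
  by have := mU measurableT A mA; rewrite setTI.
split; first exact: (@indep_integrableM _ _ _ _ U' V').
exact: (@indep_expectationM _ _ _ _ U' V').
Qed.

End Past.
End IndependentSequence.

(** * Maximal inequalities *)

Section RunningMax.
Variable R : realType.
Implicit Types f g : nat -> R.

Fixpoint rmax f (n : nat) : R :=
  if n is m.+1 then Num.max (rmax f m) (f m.+1) else f 0%N.

Lemma rmax_ge f n i : (i <= n)%N -> f i <= rmax f n.
Proof.
elim: n => [|n IH] /=; first by rewrite leqn0 => /eqP ->.
by rewrite leq_eqVlt le_max => /orP[/eqP ->|/IH ->] //; rewrite lexx orbT.
Qed.

Lemma rmax_le f n c : (forall i, (i <= n)%N -> f i <= c) -> rmax f n <= c.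
Proof.
elim: n => [|n IH] h /=; first exact: h.
by rewrite ge_max h // IH // => i /leqW; exact: h.
Qed.

Lemma rmax_ge0 f n : 0 <= f 0%N -> 0 <= rmax f n.
Proof. by move=> /le_trans; apply; exact: rmax_ge. Qed.

(* When [f] is a submartingale the sum has nonnegative expectation, so that this pathwise
   inequality integrates to Doob's [L^2] inequality. *)
Lemma doob_pathwise f n : 0 <= f 0%N ->
  rmax f n ^+ 2 + 2 * \sum_(i < n) rmax f i * (f i.+1 - f i) <= 2 * rmax f n * f n.
Proof.
move=> f0; elim: n => [|n IH]; first by rewrite big_ord0 /=; nra.
rewrite big_ord_recr /=; have := rmax_ge0 n f0 => m0.
by case: (leP (rmax f n) (f n.+1)) => h; nra.
Qed.

(** With [m] the running maximum, [(m - 2 f n)^2 >= 0] absorbs the cross term [2 m f n] of the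
    pathwise inequality. *)
Lemma rmax_sqr_le f n : 0 <= f 0%N ->
  rmax f n ^+ 2 <= 4 * f n ^+ 2 - 4 * \sum_(i < n) rmax f i * (f i.+1 - f i).
Proof.
move=> f0; have := doob_pathwise n f0.
by have := sqr_ge0 (rmax f n - 2 * f n); nra.
Qed.

Lemma rmax_norm_le f n :
  rmax (fun i => `|f i|) n <= Num.max (rmax f n) (rmax (fun i => - f i) n).
Proof.
apply: rmax_le => i le_in; rewrite ler_norml le_max (rmax_ge _ le_in) andbT.
by rewrite lerNl le_max (rmax_ge (fun i => - f i) le_in) orbT.
Qed.

Lemma rmax_homo (phi : R -> R) f n : {homo phi : x y / x <= y} ->
  phi (rmax f n) = rmax (phi \o f) n.
Proof.
move=> hphi; elim: n => //= n <-.
by case: (leP (rmax f n) (f n.+1)) => h; [rewrite max_r // hphi|rewrite max_l // hphi // ltW].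
Qed.

End RunningMax.

(** * Integrability and expectation of real functions *)

Section Expectation.
Context (d : measure_display) (T : measurableType d) (R : realType) (P : probability T R).
Implicit Types f g : T -> R.

Definition itg f := P.-integrable setT (EFin \o f).

Lemma itg_measurable f : itg f -> measurable_fun setT f.
Proof. by move=> /integrableP[/measurable_EFinP]. Qed.

Lemma itg_le f g : measurable_fun setT f -> (forall w, `|f w| <= g w) -> itg g -> itg f.
Proof.
move=> mf fg; apply: (@le_integrable _ _ _ _ _ measurableT (EFin \o f)) => //.
  exact/measurable_EFinP.
by move=> w _ /=; rewrite lee_fin (le_trans (fg w)) // ler_norm.
Qed.

Lemma itg_cst c : itg (fun=> c).
Proof. exact: finite_measure_integrable_cst. Qed.

Lemma itg_bounded f c : measurable_fun setT f -> (forall w, `|f w| <= c) -> itg f.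
Proof. by move=> mf fc; apply: (itg_le mf fc); exact: itg_cst. Qed.

Lemma itgD f g : itg f -> itg g -> itg (fun w => f w + g w).
Proof. by move=> hf hg; apply: eq_integrable (integrableD measurableT hf hg). Qed.

Lemma itgB f g : itg f -> itg g -> itg (fun w => f w - g w).
Proof. by move=> hf hg; apply: eq_integrable (integrableB measurableT hf hg). Qed.

Lemma itgZ c f : itg f -> itg (fun w => c * f w).
Proof. by move=> hf; apply: eq_integrable (integrableZl measurableT c hf). Qed.

Lemma itg_norm f : itg f -> itg (fun w => `|f w|).
Proof.
move=> hf; apply: eq_integrable (integrable_norm hf) => //.
Qed.

Lemma itg_max f g : itg f -> itg g -> itg (fun w => Num.max (f w) (g w)).
Proof.
move=> hf hg; apply: (@itg_le _ (fun w => `|f w| + `|g w|)).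
- by apply: measurable_maxr; exact: itg_measurable.
- by move=> w; have := normr_ge0 (f w); have := normr_ge0 (g w); rewrite /Num.max; case: ifP => _; lra.
- by apply: itgD; exact: itg_norm.
Qed.

Lemma itg_sum n (F : nat -> T -> R) : (forall i, (i < n)%N -> itg (F i)) ->
  itg (fun w => \sum_(i < n) F i w).
Proof.
elim: n => [|n IH] h.
  by apply: eq_integrable (itg_cst 0) => // w _; rewrite /= big_ord0.
apply: eq_integrable (itgD (IH _) (h n _)) => // [w _|i /ltnW]; last exact: h.
by rewrite /= big_ord_recr.
Qed.

Lemma itg_sqr_itg f : measurable_fun setT f -> itg (fun w => f w ^+ 2) -> itg f.
Proof.
move=> mf hf; apply: (@itg_le _ (fun w => 1 + f w ^+ 2)) => //.
  by move=> w; rewrite -real_normK ?num_real //; have := sqr_ge0 (`|f w| - 1); nra.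
by apply: itgD => //; exact: itg_cst.
Qed.

Lemma Ex_cst c : \int[P]_(_ in setT) c = c.
Proof. by rewrite Rintegral_cst //=; have -> := @probability_setT _ _ _ P; rewrite mulr1. Qed.

Lemma ExD f g : itg f -> itg g ->
  \int[P]_w (f w + g w) = \int[P]_w f w + \int[P]_w g w.
Proof. exact: RintegralD. Qed.

Lemma ExB f g : itg f -> itg g ->
  \int[P]_w (f w - g w) = \int[P]_w f w - \int[P]_w g w.
Proof. exact: RintegralB. Qed.

Lemma ExZ c f : itg f -> \int[P]_w (c * f w) = c * \int[P]_w f w.
Proof. exact: RintegralZl. Qed.

Lemma Ex_sum n (F : nat -> T -> R) : (forall i, (i < n)%N -> itg (F i)) ->
  \int[P]_w (\sum_(i < n) F i w) = \sum_(i < n) \int[P]_w F i w.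
Proof.
elim: n => [|n IH] h.
  by under eq_Rintegral do rewrite big_ord0; rewrite big_ord0 Ex_cst.
under eq_Rintegral do rewrite big_ord_recr.
rewrite big_ord_recr /= -IH; last by move=> i /ltnW; exact: h.
by apply: ExD; [apply: itg_sum => i /ltnW; exact: h|exact: h].
Qed.

Lemma le_Ex f g : itg f -> itg g -> (forall w, f w <= g w) ->
  \int[P]_w f w <= \int[P]_w g w.
Proof. by move=> hf hg h; apply: le_Rintegral. Qed.

Lemma Ex_ge0 f : (forall w, 0 <= f w) -> 0 <= \int[P]_w f w.
Proof. by move=> h; apply: Rintegral_ge0. Qed.

Lemma itg_rmax (W : nat -> T -> R) n : (forall i, (i <= n)%N -> itg (W i)) ->
  itg (fun w => rmax (W^~ w) n).
Proof.
elim: n => [|n IH] h; first exact: h.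
by apply: itg_max; [apply: IH => i /leqW; exact: h|exact: h].
Qed.

Lemma measurable_rmax d' (T' : measurableType d') (W : nat -> T' -> R) n :
  (forall i, (i <= n)%N -> measurable_fun setT (W i)) ->
  measurable_fun setT (fun w => rmax (W^~ w) n).
Proof.
elim: n => [|n IH] h; first exact: h.
by apply: measurable_maxr; [apply: IH => i /leqW; exact: h|exact: h].
Qed.

(** The last hypothesis is the only consequence of the submartingale property that the pathwise
    inequality uses: increments have nonnegative mean when weighted by the running maximum. *)
Lemma doob_L2 (W : nat -> T -> R) n :
  (forall i, (i <= n)%N -> measurable_fun setT (W i)) -> (forall w, 0 <= W 0%N w) ->
  itg (fun w => W n w ^+ 2) ->
  (forall i, (i < n)%N -> itg (fun w => rmax (W^~ w) i * (W i.+1 w - W i w))) ->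
  (forall i, (i < n)%N -> 0 <= \int[P]_w (rmax (W^~ w) i * (W i.+1 w - W i w))) ->
  itg (fun w => rmax (W^~ w) n ^+ 2) /\
  \int[P]_w (rmax (W^~ w) n ^+ 2) <= 4 * \int[P]_w (W n w ^+ 2).
Proof.
move=> mW W0 iW ii ge0.
pose D i w := rmax (W^~ w) i * (W i.+1 w - W i w).
have iS : itg (fun w => \sum_(i < n) D i w) by apply: itg_sum.
have iB : itg (fun w => 4 * W n w ^+ 2 - 4 * \sum_(i < n) D i w).
  by apply: itgB; apply: itgZ.
have le w : rmax (W^~ w) n ^+ 2 <= 4 * W n w ^+ 2 - 4 * \sum_(i < n) D i w.
  exact: rmax_sqr_le.
have im : itg (fun w => rmax (W^~ w) n ^+ 2).
  apply: (itg_le _ _ iB); last by move=> w; rewrite ger0_norm ?sqr_ge0.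
  by apply: measurable_funX; exact: measurable_rmax.
split=> //; apply: (le_trans (le_Ex im iB le)).
rewrite ExB ?ExZ //; try exact: itgZ.
rewrite (Ex_sum (F := D)) // gerBl mulr_ge0 // sumr_ge0 // => i _.
exact: ge0.
Qed.

End Expectation.

Section MaximalInequalities.
Context (d : measure_display) (T : measurableType d) (R : realType) (P : probability T R).
Variables (X : nat -> T -> R) (M : nat).
Hypothesis mX : forall i, measurable_fun setT (X i).
Hypothesis iX : indep_seq P M X.
Hypothesis X0 : forall i, (i < M)%N -> \int[P]_w X i w = 0.
Hypothesis iX2 : forall i, (i < M)%N -> itg P (fun w => X i w ^+ 2).

Definition psum (X : nat -> T -> R) m w := \sum_(i < m) X i w.

Let itX i : (i < M)%N -> itg P (X i).
Proof. by move=> iM; apply: itg_sqr_itg => //; exact: iX2. Qed.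

Let itg_psum m : (m <= M)%N -> itg P (psum X m).
Proof. by move=> mM; apply: itg_sum => i im; apply: itX; exact: leq_trans mM. Qed.

Lemma past_psum j m : (m <= j)%N -> past_measurable X j (psum X m).
Proof.
move=> mj; apply: (@measurable_sum _ (g_sigma_algebraType (past_cylinder X j))) => i.
by apply: past_measurableX; exact: leq_trans mj.
Qed.

Lemma psumS m w : psum X m.+1 w = psum X m w + X m w.
Proof. by rewrite /psum big_ord_recr. Qed.

(** Orthogonality: the cross term of [psum X m] with the next centered variable has mean zero. *)
Lemma psum_L2 m : (m <= M)%N -> itg P (fun w => psum X m w ^+ 2) /\
  \int[P]_w (psum X m w ^+ 2) = \sum_(i < m) \int[P]_w (X i w ^+ 2).
Proof.
elim: m => [|m IH] mM.
  rewrite big_ord0 -[RHS](Ex_cst P 0); split.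
    by apply: eq_integrable (itg_cst P 0) => // w _ /=; rewrite /psum big_ord0 expr0n.
  by apply: eq_Rintegral => w _; rewrite /psum big_ord0 expr0n.
have [i2 E2] := IH (ltnW mM).
have [icross Ecross] := @indep_pastM _ _ _ P X M m mX iX mM (psum X m) idfun
  (past_psum (leqnn m)) (@measurable_id _ _ _) (itg_psum (ltnW mM)) (itX mM).
rewrite /= X0 // mulr0 in Ecross.
have e w : psum X m.+1 w ^+ 2 = (psum X m w ^+ 2 + 2 * (psum X m w * X m w)) + X m w ^+ 2.
  by rewrite psumS; ring.
have i1 : itg P (fun w => psum X m w ^+ 2 + 2 * (psum X m w * X m w)).
  by apply: itgD => //; exact: itgZ.
split.
  by apply: eq_integrable (itgD i1 (iX2 mM)) => // w _ /=; rewrite e.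
under eq_Rintegral do rewrite e.
rewrite ExD ?iX2 // ExD //; last exact: itgZ.
by rewrite ExZ // Ecross mulr0 addr0 E2 big_ord_recr.
Qed.

(** The running maximum up to [i] depends on the past of [i], so its product with the next
    increment, a centered independent variable, has mean zero. *)
Lemma psum_max_L2 m : (m <= M)%N ->
  itg P (fun w => rmax (psum X ^~ w) m ^+ 2) /\
  \int[P]_w (rmax (psum X ^~ w) m ^+ 2) <= 4 * \sum_(i < m) \int[P]_w (X i w ^+ 2).
Proof.
move=> mM; have [i2 <-] := psum_L2 mM.
have key i : (i < m)%N ->
    itg P (fun w => rmax (psum X ^~ w) i * (psum X i.+1 w - psum X i w)) /\
    \int[P]_w (rmax (psum X ^~ w) i * (psum X i.+1 w - psum X i w)) = 0.
  move=> im; have iM := leq_trans im mM.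
  have pm : past_measurable X i (fun w => rmax (psum X ^~ w) i).
    apply: (@measurable_rmax R _ (g_sigma_algebraType (past_cylinder X i))) => k ki.
    exact: past_psum.
  have ir : itg P (fun w => rmax (psum X ^~ w) i).
    by apply: itg_rmax => k ki; apply: itg_psum; rewrite (leq_trans ki) // ltnW.
  have [ic Ec] := @indep_pastM _ _ _ P X M i mX iX iM _ idfun
    pm (@measurable_id _ _ _) ir (itX iM).
  rewrite /= X0 // mulr0 in Ec.
  have e w : rmax (psum X ^~ w) i * (psum X i.+1 w - psum X i w)
      = rmax (psum X ^~ w) i * X i w by rewrite psumS; ring.
  split; first by apply: eq_integrable ic => // w _ /=; rewrite e.
  by under eq_Rintegral do rewrite e.
apply: doob_L2 => //.
- by move=> i im; apply: itg_measurable (itg_psum _); exact: leq_trans mM.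
- by move=> w; rewrite /psum big_ord0.
- by move=> i /key[].
- by move=> i /key[_ ->].
Qed.

End MaximalInequalities.

(* Squaring [exp (- x / 2) >= 1 - x / 2] gives [exp x <= (1 - x / 2)^-2]. *)
Lemma expR_le_quadratic (R : realType) (x : R) : `|x| <= 1 -> expR x <= 1 + x + 2 * x ^+ 2.
Proof.
rewrite ler_norml => /andP[x1 x2].
have h : 1 - x / 2 <= expR (- (x / 2)) by have := expR_ge1Dx (- (x / 2)); lra.
have e : expR (- (x / 2)) ^+ 2 * expR x = 1.
  by rewrite -expRM_natl -expRD (_ : _ + _ = 0) ?expR0 //; lra.
have p : (1 - x / 2) ^+ 2 * expR x <= 1.
  rewrite -[leRHS]e ler_pM2r ?expR_gt0 // lerXn2r ?nnegrE ?expR_ge0 //.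
  by lra.
have q : 1 <= (1 - x / 2) ^+ 2 * (1 + x + 2 * x ^+ 2).
  by have := mulr_ge0 (sqr_ge0 x) (mulr_ge0 (_ : 0 <= 1 - x) (_ : 0 <= 5 - 2 * x)); nra.
have r : 0 < (1 - x / 2) ^+ 2 by rewrite exprn_gt0 //; lra.
by rewrite -(ler_pM2l r) (le_trans p q).
Qed.

(** * Exponential maximal inequality for bounded variables *)

Section ExponentialMaximal.
Context (d : measure_display) (T : measurableType d) (R : realType) (P : probability T R).
Variables (X : nat -> T -> R) (M : nat) (b v r : R).
Hypothesis mX : forall i, measurable_fun setT (X i).
Hypothesis iX : indep_seq P M X.
Hypothesis X0 : forall i, (i < M)%N -> \int[P]_w X i w = 0.
Hypothesis Xb : forall i w, (i < M)%N -> `|X i w| <= b.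
Hypothesis Xv : forall i, (i < M)%N -> \int[P]_w (X i w ^+ 2) <= v.
Hypothesis rb : `|r| * b <= 2^-1.

(** Exponents up to [2 r] are needed because Doob's inequality squares [expR (r * psum X i w)]. The
    bound [1/2] on [|r| b] keeps them in the range of the quadratic estimate. *)
Let cX c i w : `|c| <= 2 * `|r| -> (i < M)%N -> `|c * X i w| <= 1.
Proof.
move=> cr iM; rewrite normrM; have := Xb w iM; have := normr_ge0 (X i w) => h0 h1.
have : `|c| * `|X i w| <= 2 * `|r| * b by apply: ler_pM.
by move: rb; lra.
Qed.

Let itX i : (i < M)%N -> itg P (X i).
Proof. by move=> iM; apply: (@itg_bounded _ _ _ _ _ b) => // w; exact: Xb. Qed.

Let itX2 i : (i < M)%N -> itg P (fun w => X i w ^+ 2).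
Proof.
move=> iM; apply: (@itg_bounded _ _ _ _ _ (b ^+ 2)); first exact: measurable_funX.
move=> w; rewrite normrX lerXn2r ?nnegrE //; first exact: le_trans (Xb w iM).
exact: Xb.
Qed.

Let mexp c : measurable_fun setT (fun x : R => expR (c * x)).
Proof. by apply: measurableT_comp => //; exact: mulrl_measurable. Qed.

Let itexpX c i : `|c| <= 2 * `|r| -> (i < M)%N -> itg P (fun w => expR (c * X i w)).
Proof.
move=> cr iM; apply: (@itg_bounded _ _ _ _ _ (expR 1)).
  by apply: (measurableT_comp (mexp c)).
move=> w; rewrite ger0_norm ?expR_ge0 // ler_expR.
exact: le_trans (ler_norm _) (cX w cr iM).
Qed.

Let psum_le c m w : `|c| <= 2 * `|r| -> (m <= M)%N -> c * psum X m w <= m%:R.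
Proof.
move=> cr; elim: m => [|m IH] mM; first by rewrite /psum big_ord0 mulr0.
rewrite psumS mulrDr -natr1; apply: lerD; first exact: IH (ltnW mM).
exact: le_trans (ler_norm _) (cX w cr mM).
Qed.

Let pexp c j m : (m <= j)%N -> past_measurable X j (fun w => expR (c * psum X m w)).
Proof.
move=> mj.
exact: (@measurableT_comp _ _ _ (g_sigma_algebraType (past_cylinder X j)) _ _
  (fun x : R => expR (c * x)) setT (psum X m) (mexp c) (past_psum mj)).
Qed.

Let itexp c m : `|c| <= 2 * `|r| -> (m <= M)%N -> itg P (fun w => expR (c * psum X m w)).
Proof.
move=> cr mM; apply: (@itg_bounded _ _ _ _ _ (expR m%:R)).
  exact: (past_measurableW mX (pexp c (leqnn m))).
by move=> w; rewrite ger0_norm ?expR_ge0 // ler_expR psum_le.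
Qed.

Let r2 : `|2 * r| <= 2 * `|r|. Proof. by rewrite normrM ger0_norm. Qed.
Let r1 : `|r| <= 2 * `|r|. Proof. by have := normr_ge0 r; lra. Qed.

(** The quadratic estimate at [2 r X]: the linear term has mean zero and the quadratic one at most
    [2 (2 r)^2 v]. *)
Let mgf1 i : (i < M)%N -> \int[P]_w expR (2 * r * X i w) <= expR (8 * r ^+ 2 * v).
Proof.
move=> iM.
have i1 : itg P (fun w => 1 + 2 * r * X i w).
  by apply: itgD; [exact: itg_cst|apply: itgZ; exact: itX].
have i2 : itg P (fun w => 8 * r ^+ 2 * X i w ^+ 2) by apply: itgZ; exact: itX2.
apply: (@le_trans _ _ (\int[P]_w (1 + 2 * r * X i w + 8 * r ^+ 2 * X i w ^+ 2))).
  apply: le_Ex; [exact: itexpX|exact: itgD|move=> w].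
  by apply: (le_trans (expR_le_quadratic (cX w r2 iM))); nra.
rewrite ExD // ExD ?Ex_cst; [|exact: itg_cst|by apply: itgZ; exact: itX].
rewrite (ExZ _ (itX2 iM)) (ExZ _ (itX iM)) X0 // mulr0 addr0.
apply: le_trans (expR_ge1Dx _); rewrite lerD2l; apply: ler_wpM2l; last exact: Xv.
by rewrite mulr_ge0 // sqr_ge0.
Qed.

Lemma psum_mgf m : (m <= M)%N ->
  \int[P]_w expR (2 * r * psum X m w) <= expR (8 * r ^+ 2 * v * m%:R).
Proof.
elim: m => [|m IH] mM.
  rewrite mulr0 expR0 -[leRHS](Ex_cst P 1) le_eqVlt; apply/orP; left; apply/eqP.
  by apply: eq_Rintegral => w _; rewrite /psum big_ord0 mulr0 expR0.
have [_ E] := @indep_pastM _ _ _ P X M m mX iX mM _ (fun x => expR (2 * r * x))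
  (pexp (2 * r) (leqnn m)) (mexp _) (itexp r2 (ltnW mM)) (itexpX r2 mM).
rewrite (_ : \int[P]_w _ = \int[P]_w (expR (2 * r * psum X m w) * expR (2 * r * X m w))); last first.
  by apply: eq_Rintegral => w _; rewrite psumS mulrDr expRD.
rewrite E -[m.+1%:R]natr1 mulrDr mulr1 expRD; apply: ler_pM; rewrite ?IH ?mgf1 // ?(ltnW mM) //.
  by apply: Ex_ge0 => w; exact: expR_ge0.
by apply: Ex_ge0 => w; exact: expR_ge0.
Qed.

(** The exponentials of [r] times the partial sums form a submartingale, so Doob's [L^2] inequality
    reduces the maximum to the moment generating function at [2 r]. *)
Lemma psum_max_exp m : (m <= M)%N ->
  itg P (fun w => rmax (fun i => expR (r * psum X i w)) m ^+ 2) /\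
  \int[P]_w (rmax (fun i => expR (r * psum X i w)) m ^+ 2)
    <= 4 * expR (8 * r ^+ 2 * v * m%:R).
Proof.
move=> mM.
pose W i w := expR (r * psum X i w).
have W2 w : W m w ^+ 2 = expR (2 * r * psum X m w) by rewrite /W -expRM_natl mulrA.
suff [i1 E1] : itg P (fun w => rmax (W^~ w) m ^+ 2) /\
    \int[P]_w (rmax (W^~ w) m ^+ 2) <= 4 * \int[P]_w (W m w ^+ 2).
  split=> //; apply: (le_trans E1); apply: ler_wpM2l => //.
  by under eq_Rintegral do rewrite W2; exact: psum_mgf.
have key i : (i < m)%N ->
    itg P (fun w => rmax (W^~ w) i * (W i.+1 w - W i w)) /\
    0 <= \int[P]_w (rmax (W^~ w) i * (W i.+1 w - W i w)).
  move=> im; have iM := leq_trans im mM.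
  have pm : past_measurable X i (fun w => rmax (W^~ w) i * W i w).
    apply: (@measurable_funM _ (g_sigma_algebraType (past_cylinder X i))); last exact: pexp.
    apply: (@measurable_rmax R _ (g_sigma_algebraType (past_cylinder X i))) => k ki.
    exact: pexp.
  have r0 w : 0 <= rmax (W^~ w) i by apply: rmax_ge0; exact: expR_ge0.
  have ir : itg P (fun w => rmax (W^~ w) i * W i w).
    apply: (@itg_bounded _ _ _ _ _ (expR i%:R * expR i%:R)).
      exact: (past_measurableW mX pm).
    move=> w; rewrite ger0_norm ?mulr_ge0 ?expR_ge0 //.
    apply: ler_pM; rewrite ?expR_ge0 //; last by rewrite ler_expR psum_le // ltnW.
    apply: rmax_le => k ki; rewrite ler_expR.
    by rewrite (le_trans (psum_le _ _ _)) ?ler_nat // (leq_trans ki) // ltnW.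
  have mphi : measurable_fun setT (fun x : R => expR (r * x) - 1).
    by apply: measurable_funB.
  have iphi : itg P (fun w => expR (r * X i w) - 1).
    by apply: itgB; [exact: itexpX|exact: itg_cst].
  have [ic Ec] := @indep_pastM _ _ _ P X M i mX iX iM _ (fun x => expR (r * x) - 1)
    pm mphi ir iphi.
  have e w : rmax (W^~ w) i * (W i.+1 w - W i w)
      = rmax (W^~ w) i * W i w * (expR (r * X i w) - 1).
    by rewrite /W psumS (mulrDr r) expRD; ring.
  split; first by apply: eq_integrable ic => // w _ /=; rewrite e.
  under eq_Rintegral do rewrite e.
  rewrite Ec mulr_ge0 //; first by apply: Ex_ge0 => w; rewrite mulr_ge0 ?expR_ge0.
  (* The submartingale property: [expR x - 1 >= x], and [r * X i] has mean zero. *)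
  rewrite -(mulr0 r) -(X0 iM) -ExZ; last exact: itX.
  by apply: le_Ex => //; [apply: itgZ; exact: itX|move=> w; have := expR_ge1Dx (r * X i w); lra].
apply: doob_L2.
- move=> i im; exact: (past_measurableW mX (pexp r (leqnn i))).
- by move=> w; exact: expR_ge0.
- by apply: eq_integrable (itexp r2 mM) => // w _ /=; rewrite W2.
- by move=> i /key[].
- by move=> i /key[].
Qed.

End ExponentialMaximal.

Section AbsoluteMaximal.
Context (d : measure_display) (T : measurableType d) (R : realType) (P : probability T R).
Variables (X : nat -> T -> R) (M : nat).
Hypothesis mX : forall i, measurable_fun setT (X i).
Hypothesis iX : indep_seq P M X.
Hypothesis X0 : forall i, (i < M)%N -> \int[P]_w X i w = 0.

Definition psup (X : nat -> T -> R) m w := rmax (fun i => `|psum X i w|) m.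

Lemma psup_ge0 m w : 0 <= psup X m w.
Proof. by apply: rmax_ge0. Qed.

Lemma measurable_psup m : measurable_fun setT (psup X m).
Proof.
apply: measurable_rmax => i _; apply: measurableT_comp => //.
by apply: measurable_sum => j.
Qed.

Let X' i w := - X i w.
Let mX' i : measurable_fun setT (X' i).
Proof. exact: measurableT_comp. Qed.
Let iX' : indep_seq P M X'.
Proof. exact: (indep_seq_comp (phi := fun=> -%R)). Qed.
Let psumN i w : psum X' i w = - psum X i w.
Proof. by rewrite /psum sumrN. Qed.
Let psumNE w : (fun i => psum X' i w) = (fun i => - psum X i w).
Proof. by apply/funext => i; exact: psumN. Qed.

(** The one-sided bound is applied to [X] and to [-X]. As [psup] is nonnegative, its square is at
    most the sum of the two squared maxima, whence [8 = 4 + 4]. *)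
Lemma psup_L2 m : (forall i, (i < M)%N -> itg P (fun w => X i w ^+ 2)) -> (m <= M)%N ->
  itg P (fun w => psup X m w ^+ 2) /\
  \int[P]_w (psup X m w ^+ 2) <= 8 * \sum_(i < m) \int[P]_w (X i w ^+ 2).
Proof.
move=> iX2 mM.
have [i1 E1] := psum_max_L2 mX iX X0 iX2 mM.
have [i2 E2] : itg P (fun w => rmax (psum X' ^~ w) m ^+ 2) /\
  \int[P]_w (rmax (psum X' ^~ w) m ^+ 2) <= 4 * \sum_(i < m) \int[P]_w (X' i w ^+ 2).
  apply: (psum_max_L2 mX' iX') => // i iM.
    rewrite -[RHS]oppr0 -(X0 iM) -[RHS]mulN1r -ExZ; last by apply: itg_sqr_itg => //; exact: iX2.
    by apply: eq_Rintegral => w _; rewrite mulN1r.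
  by apply: eq_integrable (iX2 _ iM) => // w _ /=; rewrite /X' sqrrN.
have le w : psup X m w ^+ 2 <= rmax (psum X ^~ w) m ^+ 2 + rmax (psum X' ^~ w) m ^+ 2.
  have := rmax_norm_le (psum X ^~ w) m; rewrite -psumNE -/(psup X m w) => h.
  have p0 := psup_ge0 m w.
  have sq x : psup X m w <= x -> psup X m w ^+ 2 <= x ^+ 2 by move=> px; nra.
  have s1 := sqr_ge0 (rmax (psum X ^~ w) m); have s2 := sqr_ge0 (rmax (psum X' ^~ w) m).
  by move: h; rewrite le_max => /orP[] /sq; lra.
have i3 := itgD i1 i2.
have i4 : itg P (fun w => psup X m w ^+ 2).
  apply: (itg_le _ _ i3); first by apply: measurable_funX; exact: measurable_psup.
  by move=> w; rewrite ger0_norm ?sqr_ge0.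
split=> //; apply: (le_trans (le_Ex i4 i3 le)); rewrite ExD //.
apply: (le_trans (lerD E1 E2)).
under [X in _ + 4 * X <= _]eq_bigr => i _ do under eq_Rintegral do rewrite /X' sqrrN.
by rewrite -mulrDl; lra.
Qed.

(** The one-sided exponential bound is used for [X] and [-X] at [r = lam / 2], since it controls the
    square of the maximal exponential; [8 (lam / 2)^2] becomes [2 lam^2]. *)
Lemma psup_exp (b v lam : R) m : (forall i w, (i < M)%N -> `|X i w| <= b) ->
  (forall i, (i < M)%N -> \int[P]_w (X i w ^+ 2) <= v) ->
  0 <= lam -> lam * b <= 1 -> (m <= M)%N ->
  itg P (fun w => expR (lam * psup X m w)) /\
  \int[P]_w expR (lam * psup X m w) <= 8 * expR (2 * lam ^+ 2 * v * m%:R).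
Proof.
move=> Xb Xv lam0 lamb mM.
have r0 : 0 <= lam / 2 by lra.
have hb : `|lam / 2| * b <= 2^-1 by rewrite ger0_norm //; lra.
have [i1 E1] := psum_max_exp mX iX X0 Xb Xv hb mM.
have [i2 E2] : itg P (fun w => rmax (fun i => expR (lam / 2 * psum X' i w)) m ^+ 2) /\
  \int[P]_w (rmax (fun i => expR (lam / 2 * psum X' i w)) m ^+ 2)
    <= 4 * expR (8 * (lam / 2) ^+ 2 * v * m%:R).
  apply: (psum_max_exp (b := b) mX' iX') => // i.
  - move=> iM; rewrite -[RHS]oppr0 -(X0 iM) -[RHS]mulN1r -ExZ; last first.
      by apply: (@itg_bounded _ _ _ _ _ b) => // w; exact: Xb.
    by apply: eq_Rintegral => w _; rewrite mulN1r.
  - by move=> w iM; rewrite /X' normrN; exact: Xb.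
  - by move=> iM; under eq_Rintegral do rewrite /X' sqrrN; exact: Xv.
have homo : {homo (fun x : R => expR (lam / 2 * x)) : x y / x <= y}.
  by move=> x y xy; rewrite ler_expR; apply: ler_wpM2l.
have le w : expR (lam * psup X m w) <= rmax (fun i => expR (lam / 2 * psum X i w)) m ^+ 2 +
    rmax (fun i => expR (lam / 2 * psum X' i w)) m ^+ 2.
  rewrite -[rmax _ m](rmax_homo (phi := fun x => expR (lam / 2 * x)) (psum X ^~ w) m homo).
  rewrite -[X in _ + X ^+ 2](rmax_homo (phi := fun x => expR (lam / 2 * x)) (psum X' ^~ w) m homo).
  have := rmax_norm_le (psum X ^~ w) m; rewrite -psumNE -/(psup X m w) => h.
  rewrite -!expRM_natl; apply: (le_trans (_ : _ <= expR (lam * Num.max (rmax (psum X ^~ w) m) (rmax (psum X' ^~ w) m)))).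
    by rewrite ler_expR; apply: ler_wpM2l.
  have e x : (2%:R * (lam / 2 * x)) = lam * x by rewrite mulrA mulrC; field.
  by rewrite !e /Num.max; case: ifP => _; rewrite ?lerDr ?lerDl expR_ge0.
have i3 := itgD i1 i2.
have i4 : itg P (fun w => expR (lam * psup X m w)).
  apply: (itg_le _ _ i3); last by move=> w; rewrite ger0_norm ?expR_ge0.
  apply: measurableT_comp => //; apply: measurable_funM => //; exact: measurable_psup.
split=> //; apply: (le_trans (le_Ex i4 i3 le)); rewrite ExD //.
apply: (le_trans (lerD E1 E2)).
have -> : 8 * (lam / 2) ^+ 2 = 2 * lam ^+ 2 by field.
by rewrite -mulrDl; lra.
Qed.

End AbsoluteMaximal.

(** * Truncation and the excess of one block *)

Section Truncation.
Variable R : realType.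
Implicit Types q x : R.

Definition trunc q x : R := if x ^+ 2 <= q then x else 0.
Definition tail q x : R := if x ^+ 2 <= q then 0 else x.

Lemma trunc_tail q x : trunc q x + tail q x = x.
Proof. by rewrite /trunc /tail; case: ifP => _; rewrite ?addr0 ?add0r. Qed.

Lemma measurable_trunc q : measurable_fun setT (trunc q).
Proof.
apply: measurable_fun_ifT => //.
by apply: measurable_fun_ler => //; exact: measurable_funX.
Qed.

Lemma measurable_tail q : measurable_fun setT (tail q).
Proof.
apply: measurable_fun_ifT => //.
by apply: measurable_fun_ler => //; exact: measurable_funX.
Qed.

Lemma trunc_sqr_le q x : trunc q x ^+ 2 <= x ^+ 2.
Proof. by rewrite /trunc; case: ifP => _ //; rewrite expr0n sqr_ge0. Qed.

Lemma tail_sqr_le q x : tail q x ^+ 2 <= x ^+ 2.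
Proof. by rewrite /tail; case: ifP => _ //; rewrite expr0n sqr_ge0. Qed.

Lemma trunc_bound q x : 0 <= q -> `|trunc q x| <= Num.sqrt q.
Proof.
move=> q0; rewrite /trunc; case: ifP => h; last by rewrite normr0 sqrtr_ge0.
by rewrite -sqrtr_sqr ler_wsqrtr.
Qed.

End Truncation.

Lemma sqr_le_expR (R : realType) (y : R) : 0 <= y -> y ^+ 2 / 4 <= expR y.
Proof.
move=> y0; have h := expR_ge1Dx (y / 2).
have e : expR y = expR (y / 2) ^+ 2 by rewrite -expRM_natl; congr expR; field.
by rewrite e; nra.
Qed.

(* The excess of [2 Y] over its threshold [A L], with [Y = 4 x^2 / L] and [A = 32 B^2]. *)
Lemma excess_le_expR (R : realType) (B L x : R) : 0 <= B -> 1 <= L -> 0 <= x ->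
  Num.max (8 * x ^+ 2 / L - 32 * B ^+ 2 * L) 0 <= 128 * expR (x - B * L).
Proof.
move=> B0 L1 x0; rewrite ge_max mulr_ge0 ?expR_ge0 // andbT.
have L0 : 0 < L by lra.
have BL : 0 <= B * L by rewrite mulr_ge0 // ltW.
(* Below [2 B L] the threshold is not exceeded. Above it [x - B L >= x / 2], and [expR (x / 2)]
   dominates [x^2 / 16]. *)
have [h|h] := leP x (2 * (B * L)).
  apply: (@le_trans _ _ 0); last by rewrite mulr_ge0 // expR_ge0.
  rewrite subr_le0 ler_pdivrMr //.
  have : x ^+ 2 <= (2 * (B * L)) ^+ 2 by rewrite lerXn2r ?nnegrE // mulr_ge0.
  by rewrite !exprMn; nra.
apply: (@le_trans _ _ (8 * x ^+ 2)).
  have : 8 * x ^+ 2 / L <= 8 * x ^+ 2 by rewrite ler_pdivrMr // ler_peMr // mulr_ge0 // sqr_ge0.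
  have : 0 <= 32 * B ^+ 2 * L by rewrite !mulr_ge0 // ?sqr_ge0 // ltW.
  by lra.
have x20 : 0 <= x / 2 by lra.
have := sqr_le_expR x20.
have : expR (x / 2) <= expR (x - B * L) by rewrite ler_expR; lra.
by rewrite expr_div_n; lra.
Qed.

Section BlockExcess.
Context (d : measure_display) (T : measurableType d) (R : realType) (P : probability T R).

Lemma variance_le (f : T -> R) : measurable_fun setT f -> itg P (fun w => f w ^+ 2) ->
  itg P (fun w => (f w - \int[P]_w f w) ^+ 2) /\
  \int[P]_w ((f w - \int[P]_w f w) ^+ 2) <= \int[P]_w (f w ^+ 2).
Proof.
move=> mf f2; have f1 := itg_sqr_itg mf f2; set c := \int[P]_w f w.
have e w : (f w - c) ^+ 2 = f w ^+ 2 - 2 * c * f w + c ^+ 2 by ring.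
have i1 : itg P (fun w => f w ^+ 2 - 2 * c * f w) by apply: itgB => //; exact: itgZ.
have i2 : itg P (fun w => (f w - c) ^+ 2).
  by apply: eq_integrable (itgD i1 (itg_cst P (c ^+ 2))) => // w _ /=; rewrite e.
split=> //; under eq_Rintegral do rewrite e.
rewrite ExD ?Ex_cst //; last exact: itg_cst.
rewrite ExB //; last exact: itgZ.
by rewrite ExZ // -/c; have := sqr_ge0 c; nra.
Qed.

Variables (X : nat -> T -> R) (M : nat) (v L g : R) (t N : nat).
Hypothesis mX : forall i, measurable_fun setT (X i).
Hypothesis iX : indep_seq P M X.
Hypothesis X0 : forall i, (i < M)%N -> \int[P]_w X i w = 0.
Hypothesis iX2 : forall i, (i < M)%N -> itg P (fun w => X i w ^+ 2).
Hypothesis Xv : forall i, (i < M)%N -> \int[P]_w (X i w ^+ 2) <= v.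
Hypothesis L1 : 1 <= L.
Hypothesis Xg : forall i, (i < M)%N ->
  \int[P]_w (tail (2 ^+ t / L) (X i w) ^+ 2) <= g.
Hypothesis v0 : 0 <= v.
Hypothesis g0 : 0 <= g.
Hypothesis NM : (N <= M)%N.
Hypothesis Nt : (N <= 2 ^ t.+1)%N.

Let q := 2 ^+ t / L.
Let X' i w := trunc q (X i w) - \int[P]_w trunc q (X i w).
Let X'' i w := tail q (X i w) - \int[P]_w tail q (X i w).

Let q0 : 0 < q.
Proof. by rewrite divr_gt0 ?exprn_gt0 //; move: L1; lra. Qed.

Let mtr i : measurable_fun setT (fun w => trunc q (X i w)).
Proof. by apply: measurableT_comp => //; exact: measurable_trunc. Qed.
Let mtl i : measurable_fun setT (fun w => tail q (X i w)).
Proof. by apply: measurableT_comp => //; exact: measurable_tail. Qed.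

Let itr2 i : (i < M)%N -> itg P (fun w => trunc q (X i w) ^+ 2).
Proof.
move=> iM; apply: (itg_le _ _ (iX2 iM)); first exact: measurable_funX.
by move=> w; rewrite ger0_norm ?sqr_ge0 // trunc_sqr_le.
Qed.
Let itl2 i : (i < M)%N -> itg P (fun w => tail q (X i w) ^+ 2).
Proof.
move=> iM; apply: (itg_le _ _ (iX2 iM)); first exact: measurable_funX.
by move=> w; rewrite ger0_norm ?sqr_ge0 // tail_sqr_le.
Qed.

Let itr i : (i < M)%N -> itg P (fun w => trunc q (X i w)).
Proof. by move=> iM; apply: itg_sqr_itg => //; exact: itr2. Qed.
Let itl i : (i < M)%N -> itg P (fun w => tail q (X i w)).
Proof. by move=> iM; apply: itg_sqr_itg => //; exact: itl2. Qed.

Let iX' : indep_seq P M X'.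
Proof.
apply: (indep_seq_comp (phi := fun i x => trunc q x - \int[P]_w trunc q (X i w)) _ iX) => i.
by apply: measurable_funB => //; exact: measurable_trunc.
Qed.
Let iX'' : indep_seq P M X''.
Proof.
apply: (indep_seq_comp (phi := fun i x => tail q x - \int[P]_w tail q (X i w)) _ iX) => i.
by apply: measurable_funB => //; exact: measurable_tail.
Qed.

Let mX' i : measurable_fun setT (X' i). Proof. exact: measurable_funB. Qed.
Let mX'' i : measurable_fun setT (X'' i). Proof. exact: measurable_funB. Qed.

Let X'0 i : (i < M)%N -> \int[P]_w X' i w = 0.
Proof. by move=> iM; rewrite ExB ?Ex_cst ?subrr //; [exact: itr|exact: itg_cst]. Qed.
Let X''0 i : (i < M)%N -> \int[P]_w X'' i w = 0.
Proof. by move=> iM; rewrite ExB ?Ex_cst ?subrr //; [exact: itl|exact: itg_cst]. Qed.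

(** The two centerings cancel because [X i] has mean zero. *)
Let X'X'' i w : (i < M)%N -> X i w = X' i w + X'' i w.
Proof.
move=> iM; have : \int[P]_w trunc q (X i w) + \int[P]_w tail q (X i w) = 0.
  rewrite -(X0 iM) -ExD; [|exact: itr|exact: itl].
  by apply: eq_Rintegral => w' _; rewrite trunc_tail.
by have := trunc_tail q (X i w); rewrite /X' /X''; lra.
Qed.

Let X'b i w : (i < M)%N -> `|X' i w| <= 2 * Num.sqrt q.
Proof.
move=> iM; have tb x := trunc_bound x (ltW q0).
have c1 : `|\int[P]_w trunc q (X i w)| <= Num.sqrt q.
  apply: (le_trans (le_normr_Rintegral _ _)) => //; first exact: itr.
  rewrite -[leRHS](Ex_cst P); apply: le_Ex => //; last exact: itg_cst.
  by apply: itg_norm; exact: itr.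
apply: (le_trans (ler_normB _ _)); have := tb (X i w); lra.
Qed.

Let X'v i : (i < M)%N -> \int[P]_w (X' i w ^+ 2) <= v.
Proof.
move=> iM; have [_ h] := variance_le (mtr i) (itr2 iM).
apply: (le_trans h); apply: le_trans (Xv iM).
by apply: le_Ex; [exact: itr2|exact: iX2|move=> w; exact: trunc_sqr_le].
Qed.

Let X''2 i : (i < M)%N -> itg P (fun w => X'' i w ^+ 2).
Proof. by move=> iM; have [] := variance_le (mtl i) (itl2 iM). Qed.
Let X''g i : (i < M)%N -> \int[P]_w (X'' i w ^+ 2) <= g.
Proof. by move=> iM; have [_ h] := variance_le (mtl i) (itl2 iM); exact: le_trans (Xg iM). Qed.

(** The largest exponent allowed by the bound [2 sqrt q] on the truncated variables. With
    [q = 2^t / L] it gives [lam^2 = L / (4 * 2^t)], so that [2 Y'] equals [8 (lam * psup)^2 / L]. *)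
Let lam := (2 * Num.sqrt q)^-1.
Let Y' w := psup X' N w ^+ 2 / 2 ^+ t.
Let Y'' w := psup X'' N w ^+ 2 / 2 ^+ t.
Let A := 32 * (1 + v) ^+ 2 * L.
Let p2 : 0 < 2 ^+ t :> R. Proof. exact: exprn_gt0. Qed.
Let sq0 : 0 < Num.sqrt q. Proof. by rewrite sqrtr_gt0. Qed.
Let lam0 : 0 < lam. Proof. by rewrite invr_gt0 mulr_gt0. Qed.
Let lam2 : lam ^+ 2 = L / (4 * 2 ^+ t).
Proof.
have Lp : 0 < L by move: L1; lra.
rewrite /lam exprVn exprMn sqr_sqrtr ?(ltW q0) // /q.
by field; rewrite !gt_eqF.
Qed.
Let Nt' : N%:R <= 2 * 2 ^+ t :> R.
Proof. by rewrite -exprS -natrX ler_nat. Qed.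

Let mY' : measurable_fun setT Y'.
Proof. by apply: measurable_funM => //; apply: measurable_funX; exact: measurable_psup. Qed.

(** The threshold [A] yields a factor [expR (- (1 + v) L)], while the exponential moment over at
    most [2^(t+1)] terms is at most [8 expR (v L)]. The product leaves [expR (- L)]. *)
Let excess' : itg P (fun w => Num.max (2 * Y' w - A) 0) /\
  \int[P]_w Num.max (2 * Y' w - A) 0 <= 1024 * expR (- L).
Proof.
have lamb : lam * (2 * Num.sqrt q) <= 1 by rewrite mulVf // gt_eqF // mulr_gt0.
have [i1 E1] := psup_exp mX' iX' X'0 X'b X'v (ltW lam0) lamb NM.
have Lp : 0 < L by move: L1; lra.
have le w : Num.max (2 * Y' w - A) 0 <=
    128 * expR (- ((1 + v) * L)) * expR (lam * psup X' N w).
  rewrite -mulrA -expRD [- _ + _]addrC.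
  have -> : 2 * Y' w = 8 * (lam * psup X' N w) ^+ 2 / L.
    by rewrite exprMn lam2 /Y'; field; rewrite !gt_eqF.
  apply: excess_le_expR => //; first by move: v0; lra.
  by rewrite mulr_ge0 ?psup_ge0 // ltW.
have i2 : itg P (fun w => 128 * expR (- ((1 + v) * L)) * expR (lam * psup X' N w)).
  exact: itgZ.
have i3 : itg P (fun w => Num.max (2 * Y' w - A) 0).
  apply: (itg_le _ _ i2).
    by apply: measurable_maxr => //; apply: measurable_funB => //; exact: measurable_funM.
  by move=> w; rewrite ger0_norm // le_max lexx orbT.
split=> //; apply: (le_trans (le_Ex i3 i2 le)); rewrite ExZ //.
apply: (@le_trans _ _ (128 * expR (- ((1 + v) * L)) * (8 * expR (v * L)))).
  apply: ler_wpM2l; first by rewrite mulr_ge0 // expR_ge0.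
  apply: (le_trans E1); apply: ler_wpM2l => //; rewrite ler_expR lam2.
  apply: (@le_trans _ _ (2 * (L / (4 * 2 ^+ t)) * v * (2 * 2 ^+ t))).
    by apply: ler_wpM2l => //; rewrite !mulr_ge0 // ?invr_ge0 ltW.
  by rewrite le_eqVlt; apply/orP; left; apply/eqP; field; rewrite !gt_eqF.
rewrite mulrACA -expRD le_eqVlt; apply/orP; left; apply/eqP.
by congr (_ * expR _); ring.
Qed.

(** No threshold is subtracted from the tails: the [L^2] bound on at most [2^(t+1)] terms, divided
    by [2^t], gives [8 * 2 * g]. *)
Let excess'' : itg P Y'' /\ \int[P]_w Y'' w <= 16 * g.
Proof.
have [i1 E1] := psup_L2 mX'' iX'' X''0 X''2 NM.
have e w : Y'' w = (2 ^+ t)^-1 * psup X'' N w ^+ 2 by rewrite /Y'' mulrC.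
split; first by apply: eq_integrable (itgZ (2 ^+ t)^-1 i1) => // w _ /=; rewrite e.
under eq_Rintegral do rewrite e.
rewrite ExZ // mulrC ler_pdivrMr //; apply: (le_trans E1).
apply: (@le_trans _ _ (8 * (N%:R * g))).
  apply: ler_wpM2l => //; rewrite mulr_natl -[N in _ *+ N]card_ord -sumr_const.
  by apply: ler_sum => i _; apply: X''g; exact: leq_trans NM.
have : N%:R * g <= 2 * 2 ^+ t * g by exact: ler_wpM2r.
by lra.
Qed.

Let psup_split w : psup X N w <= psup X' N w + psup X'' N w.
Proof.
apply: rmax_le => i iN.
have -> : psum X i w = psum X' i w + psum X'' i w.
  rewrite /psum -big_split; apply: eq_bigr => j _; apply: X'X''.
  by rewrite (leq_trans (ltn_ord j)) // (leq_trans iN).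
apply: (le_trans (ler_normD _ _)); apply: lerD.
  exact: (rmax_ge (fun i => `|psum X' i w|) iN).
exact: (rmax_ge (fun i => `|psum X'' i w|) iN).
Qed.

(** By [(x + y)^2 <= 2 x^2 + 2 y^2] the two parts separate, and the whole threshold is given to the
    truncated one. *)
Lemma block_excess :
  itg P (fun w => Num.max (psup X N w ^+ 2 / 2 ^+ t - A) 0) /\
  \int[P]_w Num.max (psup X N w ^+ 2 / 2 ^+ t - A) 0 <= 1024 * expR (- L) + 32 * g.
Proof.
have [i1 E1] := excess'; have [i2 E2] := excess''.
have le w : Num.max (psup X N w ^+ 2 / 2 ^+ t - A) 0 <=
    Num.max (2 * Y' w - A) 0 + 2 * Y'' w.
  have Y''0 : 0 <= Y'' w by rewrite divr_ge0 ?sqr_ge0 ?(ltW p2).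
  have m0 : 0 <= Num.max (2 * Y' w - A) 0 by rewrite le_max lexx orbT.
  have m1 : 2 * Y' w - A <= Num.max (2 * Y' w - A) 0 by rewrite le_max lexx.
  have : psup X N w ^+ 2 / 2 ^+ t <= 2 * Y' w + 2 * Y'' w.
    rewrite !mulrA -mulrDl ler_pM2r ?invr_gt0 //.
    have := psup_split w; have := psup_ge0 X N w.
    by have := sqr_ge0 (psup X' N w - psup X'' N w); nra.
  by rewrite ge_max; lra.
have i3 : itg P (fun w => Num.max (2 * Y' w - A) 0 + 2 * Y'' w).
  by apply: itgD => //; exact: itgZ.
have i4 : itg P (fun w => Num.max (psup X N w ^+ 2 / 2 ^+ t - A) 0).
  apply: (itg_le _ _ i3).
    apply: measurable_maxr => //; apply: measurable_funB => //.
    by apply: measurable_funM => //; apply: measurable_funX; exact: measurable_psup.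
  by move=> w; rewrite ger0_norm // le_max lexx orbT.
split=> //; apply: (le_trans (le_Ex i4 i3 le)).
rewrite ExD //; last exact: itgZ.
by rewrite ExZ //; lra.
Qed.

End BlockExcess.

(** * Consequences of condition (M) *)

Section FromConditionM.
Context (d : measure_display) (T : measurableType d) (R : realType) (P : probability T R).

(** Constraints are transported along the injection [e], and indices outside its image receive the
    full set. This serves to read the noise of a piece from either end. *)
Lemma mutually_independent_indep_seq n (Z : 'I_n -> T -> R) (M : nat) (e : nat -> 'I_n) :
  (forall i j, (i < M)%N -> (j < M)%N -> e i = e j -> i = j) ->
  mutually_independent P Z -> indep_seq P M (fun i => Z (e i)).
Proof.
move=> einj indZ A mA.
pose A' j := if [pick i : 'I_M | e i == j] is Some i then A i else setT.
have mA' j : measurable (A' j) by rewrite /A'; case: pickP.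
have A'e (i : 'I_M) : A' (e i) = A i.
  rewrite /A'; case: pickP => [i' /eqP /einj -> //|/(_ i)]; last by rewrite eqxx.
have A'T j : j \notin [set e i | i : 'I_M]%SET -> A' j = setT.
  move=> jn; rewrite /A'; case: pickP => // i /eqP ij.
  by case/negP: jn; apply/imsetP; exists i.
have := indZ A' mA'.
rewrite (_ : [set w | forall j, A' j (Z j w)] =
    [set w | forall i, (i < M)%N -> A i (Z (e i) w)]); last first.
  apply/seteqP; split=> w /= H.
    by move=> i iM; have := H (e i); rewrite (A'e (Ordinal iM)).
  move=> j; rewrite /A'; case: pickP => // i /eqP <-; exact: H.
move=> ->; rewrite (bigID (mem [set e i | i : 'I_M]%SET)) /=.
rewrite [X in (_ * X)%E]big1 ?mule1; last first.
  by move=> j jn; rewrite A'T // preimage_setT probability_setT.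
rewrite big_imset /=; last by move=> i j _ _ /einj h; apply/val_inj; exact: h.
by apply: eq_big => [i|i _]; rewrite ?inE // A'e.
Qed.

Lemma expectation_itg (f : T -> R) (c : R) : measurable_fun setT f -> (forall w, 0 <= f w) ->
  ('E_P[f] <= c%:E)%E -> itg P f /\ \int[P]_w f w <= c.
Proof.
move=> mf f0; rewrite unlock => h.
have i : itg P f.
  apply/integrableP; split; first exact/measurable_EFinP.
  rewrite (eq_integral (fun w => (f w)%:E)); first exact: le_lt_trans h (ltry _).
  by move=> w _ /=; rewrite ger0_norm.
split=> //; rewrite -lee_fin fineK //; exact: integrable_fin_num.
Qed.

Lemma eq_law_Ex (X Y : T -> R) (f : R -> R) :
  measurable_fun setT X -> measurable_fun setT Y ->
  (forall A, measurable A -> P (X @^-1` A) = P (Y @^-1` A)) ->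
  measurable_fun setT f -> (forall x, 0 <= f x) ->
  \int[P]_w f (X w) = \int[P]_w f (Y w).
Proof.
move=> mX mY eqXY mf f0; congr fine.
pose X' : {mfun T >-> R} := HB.pack X (@isMeasurableFun.Build _ _ _ _ X mX).
pose Y' : {mfun T >-> R} := HB.pack Y (@isMeasurableFun.Build _ _ _ _ Y mY).
have mEf : measurable_fun setT (EFin \o f) by exact/measurable_EFinP.
have f0' y : (0 <= (EFin \o f) y)%E by rewrite lee_fin.
rewrite -[LHS](@ge0_integral_distribution _ _ _ _ _ P X' (EFin \o f) mEf f0').
rewrite -[RHS](@ge0_integral_distribution _ _ _ _ _ P Y' (EFin \o f) mEf f0').
by apply: eq_measure_integral => A mA _; exact: eqXY.
Qed.

End FromConditionM.

(** * Logarithms, dyadic counts and truncated squares *)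

Section RealBounds.
Variable R : realType.
Implicit Types x y L : R.

Lemma ln2_ge : 2^-1 <= ln 2 :> R.
Proof.
rewrite -ler_expR lnK ?posrE //.
have h : `|2^-1 : R| <= 1 by rewrite ger0_norm //; lra.
by apply: (le_trans (expR_le_quadratic h)); lra.
Qed.

(** If [2^N < y], then [N ln 2 <= ln y] and [ln 2 >= 1/2] bound the first [N] terms by
    [2 ln (e + y)]. The term of index [N] itself costs at most one further logarithm. *)
Lemma count_dyadic_le (N : nat) y : 0 <= y ->
  \sum_(t < N) ((2 ^+ t < y)%R)%:R <= 3 * ln (expR 1 + y).
Proof.
move=> y0.
have e0 : 0 < expR 1 + y by have := expR_gt0 (1 : R); lra.
have l1 : 1 <= ln (expR 1 + y) by rewrite -[leLHS](expRK (1 : R)) ler_ln ?posrE ?expR_gt0 //; lra.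
elim: N => [|N IH]; first by rewrite big_ord0; lra.
rewrite big_ord_recr /=; case: ltP => h; last by rewrite addr0.
have lN : N%:R * ln 2 <= ln (expR 1 + y).
  rewrite mulr_natl -lnXn // ler_ln ?posrE ?exprn_gt0 //.
  by have := expR_gt0 (1 : R); lra.
have s : \sum_(i < N) ((2 ^+ i < y)%R)%:R <= N%:R :> R.
  rewrite -[N in leRHS]card_ord -sum1_card natr_sum; apply: ler_sum => i _.
  by rewrite ler_nat; case: (_ < _).
have : N%:R * 2^-1 <= N%:R * ln 2 :> R by apply: ler_wpM2l => //; exact: ln2_ge.
by rewrite /= mulr1n; lra.
Qed.

(** The value [x^2] is counted once for each [t] with [2^t < L x^2], hence a logarithmic number of
    times. This is where the moment of [x^2 log x^2] in condition (M) enters. *)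
Lemma tail_sqr_sum_le (N : nat) L x : 1 <= L ->
  \sum_(t < N) tail (2 ^+ t / L) x ^+ 2 <=
  3 * L * x ^+ 2 + 3 * (x ^+ 2 * ln (expR 1 + x ^+ 2)).
Proof.
move=> L1; have L0 : 0 < L by lra.
have x2 := sqr_ge0 x; have e1 := expR_gt0 (1 : R).
have -> : \sum_(t < N) tail (2 ^+ t / L) x ^+ 2 =
    x ^+ 2 * \sum_(t < N) ((2 ^+ t < x ^+ 2 * L)%R)%:R.
  rewrite mulr_sumr; apply: eq_bigr => t _; rewrite /tail ler_pdivlMr //.
  by case: leP => h /=; rewrite ?expr0n ?mulr0 ?mulr1.
have y0 : 0 <= x ^+ 2 * L by rewrite mulr_ge0 // ltW.
have h : ln (expR 1 + x ^+ 2 * L) <= L + ln (expR 1 + x ^+ 2).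
  apply: (@le_trans _ _ (ln L + ln (expR 1 + x ^+ 2))).
    rewrite -lnM ?posrE //; last by lra.
    rewrite ler_ln ?posrE; [by nra| by lra | by apply: mulr_gt0 => //; lra].
  rewrite lerD2r; have : ln (1 + (L - 1)) <= L - 1 by apply: le_ln1Dx; lra.
  by rewrite addrCA subrr addr0; lra.
have := count_dyadic_le N y0 => c.
have := ler_wpM2l x2 c; have := ler_wpM2l x2 h; lra.
Qed.

Lemma sqr_le_powR (eps x : R) : 0 < eps -> x ^+ 2 <= 1 + `|x| `^ (2 + eps).
Proof.
move=> e0; rewrite -real_normK ?num_real //; set a := `|x|.
have a0 : 0 <= a by exact: normr_ge0.
have p0 := powR_ge0 a (2 + eps).
have [a1|a1] := leP a 1.
  have : a ^+ 2 <= 1 by rewrite exprn_ile1.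
  lra.
have : a ^+ 2 <= a `^ (2 + eps).
  by rewrite -powR_mulrn //; apply: ler_powR; [exact: ltW|lra].
lra.
Qed.

(** Where the tail is nonzero, [L x^2 / 2^t > 1], so its power [eps / 2] may be inserted as a
    factor. Since [eps / 2 <= 1] and [L >= 1], the power of [L] is at most [L]. The bound decays
    geometrically in [t]. *)
Lemma tail_sqr_le_powR (eps L x : R) (t : nat) : 0 < eps < 1 -> 1 <= L ->
  tail (2 ^+ t / L) x ^+ 2 <= L * (2 `^ (- (eps / 2))) ^+ t * `|x| `^ (2 + eps).
Proof.
move=> /andP[e0 e1] L1; have L0 : 0 < L by lra.
have rho0 : 0 <= 2 `^ (- (eps / 2)) :> R by exact: powR_ge0.
rewrite /tail; case: ifP => [_|/negbT].
  by rewrite expr0n /= !mulr_ge0 ?exprn_ge0 ?powR_ge0 // ltW.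
rewrite -ltNge => h.
rewrite -(real_normK (num_real x)) in h *; set a := `|x| in h *.
have a0 : 0 <= a by exact: normr_ge0.
have a00 : 0 < a ^+ 2 by apply: le_lt_trans h; rewrite divr_ge0 ?exprn_ge0 ?ltW.
pose c := eps / 2.
have -> : a `^ (2 + eps) = a ^+ 2 * (a ^+ 2) `^ c.
  rewrite powRD; last by apply/implyP => /eqP; lra.
  by rewrite -!powR_mulrn // -powRrM; congr (_ * _ `^ _); rewrite /c; field.
suff : 1 <= L * 2 `^ (- c) ^+ t * (a ^+ 2) `^ c.
  by move=> /(ler_wpM2l (ltW a00)); rewrite mulr1 mulrCA.
have c0 : 0 <= c by rewrite /c; lra.
apply: (@le_trans _ _ (L * 2 `^ (- c) ^+ t * (2 ^+ t / L) `^ c)); last first.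
  apply: ler_wpM2l; first by rewrite mulr_ge0 ?exprn_ge0 ?powR_ge0 // ltW.
  by apply: ge0_ler_powR => //; rewrite ?nnegrE ?ltW // divr_gt0 ?exprn_gt0.
rewrite powRM ?exprn_ge0 ?invr_ge0 ?(ltW L0) //.
have -> : L * 2 `^ (- c) ^+ t * ((2 ^+ t) `^ c * (L^-1) `^ c) = L * (L^-1) `^ c.
  have -> : (2 ^+ t) `^ c = (2 `^ c) ^+ t.
    by rewrite -powR_mulrn // powRAC powR_mulrn ?powR_ge0.
  have h2 : (2 `^ c : R) != 0 by rewrite gt_eqF // powR_gt0.
  rewrite powRN exprVn; have := expf_neq0 t h2 => h3.
  by field.
rewrite -[leLHS](divff (lt0r_neq0 L0)); apply: ler_wpM2l; first exact: ltW.
by apply: ger1_powR; [rewrite invr_gt0 L0 invf_le1|rewrite /c; lra].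
Qed.

End RealBounds.

Lemma geometric_sum_le (R : realType) (x : R) (N : nat) : 0 <= x < 1 ->
  \sum_(t < N) x ^+ t <= (1 - x)^-1.
Proof.
move=> /andP[x0 x1]; rewrite -[leRHS]mul1r ler_pdivlMr ?subr_gt0 //.
have := subrX1 x N; have := exprn_ge0 N x0; nra.
Qed.

(** * Moments and tails of the normalised noise *)

Section Noise.
Context (d : measure_display) (T : measurableType d) (R : realType) (P : probability T R).
Variables (n : nat) (Z : 'I_n.+1 -> T -> R) (sigma eps C1 : R).
Hypothesis eps01 : 0 < eps < 1.
Hypothesis C10 : 0 < C1.
Hypothesis condM : condition_M P Z sigma eps C1.

Let W i w := Z i w / sigma.

Lemma noise_measurable i : measurable_fun setT (W i).
Proof. by have [mZ _ _ _] := condM; apply: measurable_funM. Qed.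

Let mW := noise_measurable.

Lemma noise_mean i : \int[P]_w W i w = 0.
Proof.
have [mZ _ /(_ i)[iZ EZ] _] := condM.
transitivity (\int[P]_w (sigma^-1 * Z i w)); first by apply: eq_Rintegral => w _; rewrite mulrC.
rewrite ExZ //; move: EZ; rewrite unlock /Rintegral => ->.
by rewrite mulr0.
Qed.

Lemma noise_indep (e : nat -> 'I_n.+1) (M : nat) :
  (forall i j, (i < M)%N -> (j < M)%N -> e i = e j -> i = j) ->
  indep_seq P M (fun i => W (e i)).
Proof.
move=> einj; have [mZ indZ _ _] := condM.
apply: (indep_seq_comp (phi := fun _ x => x / sigma) _
  (mutually_independent_indep_seq einj indZ)) => i.
by apply: measurable_funM.
Qed.

Let mpow i : measurable_fun setT (fun w => `|W i w| `^ (2 + eps)).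
Proof.
apply: (measurableT_comp (measurable_powR (2 + eps))).
exact: measurableT_comp.
Qed.

Let mlog i : measurable_fun setT (fun w => W i w ^+ 2 * ln (expR 1 + W i w ^+ 2)).
Proof.
have m2 : measurable_fun setT (fun w => W i w ^+ 2) by exact: measurable_funX.
apply: measurable_funM => //; apply: measurableT_comp => //; exact: measurable_funD.
Qed.

Let ln_ge1 x : 1 <= ln (expR 1 + x ^+ 2) :> R.
Proof.
have e1 := expR_gt0 (1 : R); have x2 := sqr_ge0 x.
by rewrite -[leLHS](expRK (1 : R)) ler_ln ?posrE //; lra.
Qed.

Let log_ge0 x : 0 <= x ^+ 2 * ln (expR 1 + x ^+ 2) :> R.
Proof. by rewrite mulr_ge0 ?sqr_ge0 // (le_trans _ (ln_ge1 x)). Qed.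

Let moments :
  (forall i, itg P (fun w => `|W i w| `^ (2 + eps)) /\
     \int[P]_w (`|W i w| `^ (2 + eps)) <= C1) \/
  ((forall i j A, measurable A -> P (W i @^-1` A) = P (W j @^-1` A)) /\
   (forall i, itg P (fun w => W i w ^+ 2 * ln (expR 1 + W i w ^+ 2)) /\
     \int[P]_w (W i w ^+ 2 * ln (expR 1 + W i w ^+ 2)) <= C1)).
Proof.
have [mZ _ _ [h|[h1 h2]]] := condM; [left|right; split] => i.
- by apply: expectation_itg; [exact: mpow|move=> w; exact: powR_ge0|exact: h].
- move=> j A mA; apply: (h1 i j (fun x => A (x / sigma))).
  rewrite -[X in measurable X]setTI.
  by apply: (_ : measurable_fun setT (fun x : R => x / sigma)) => //; apply: measurable_funM.
- apply: expectation_itg; [exact: mlog|by move=> w; exact: log_ge0|].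
  rewrite (_ : (fun w => _) = (fun w => Z i w ^+ 2 / sigma ^+ 2 * ln (expR 1 + Z i w ^+ 2 / sigma ^+ 2))) //.
  by apply/funext => w; rewrite /W expr_div_n.
Qed.

Lemma noise_sqr i : itg P (fun w => W i w ^+ 2) /\ \int[P]_w (W i w ^+ 2) <= 1 + C1.
Proof.
have m2 : measurable_fun setT (fun w => W i w ^+ 2) by exact: measurable_funX.
have /andP[e0 _] := eps01.
have [/(_ i)[i1 E1]|[_ /(_ i)[i1 E1]]] := moments.
  have le w := sqr_le_powR (W i w) e0.
  have i2 := itgD (itg_cst P 1) i1.
  have i3 : itg P (fun w => W i w ^+ 2).
    by apply: (itg_le m2 _ i2) => w; rewrite ger0_norm ?sqr_ge0.
  split=> //; apply: (le_trans (le_Ex i3 i2 le)); rewrite ExD ?Ex_cst //; last exact: itg_cst.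
  by rewrite lerD2l.
have le w : W i w ^+ 2 <= W i w ^+ 2 * ln (expR 1 + W i w ^+ 2).
  by rewrite ler_peMr ?sqr_ge0.
have i3 : itg P (fun w => W i w ^+ 2).
  by apply: (itg_le m2 _ i1) => w; rewrite ger0_norm ?sqr_ge0.
by split=> //; apply: (le_trans (le_Ex i3 i1 le)); move: E1; lra.
Qed.

(** The first summand is the geometric series of the power moment case. The second comes from the
    identically distributed case, where [3 L (1 + c) + 3 c <= (6 c + 3) L]. *)
Definition tail_const (e c : R) : R := c / (1 - 2 `^ (- (e / 2))) + (6 * c + 3).

(** The envelope [g] bounds the tails uniformly in [i], and its sum over all scales is of order [L],
    not of order [L] per scale. *)
Lemma noise_tail (L : R) : 1 <= L -> exists g : nat -> R,
  [/\ (forall t, 0 <= g t),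
      (forall i t, \int[P]_w (tail (2 ^+ t / L) (W i w) ^+ 2) <= g t) &
      (forall N, \sum_(t < N) g t <= tail_const eps C1 * L)].
Proof.
move=> L1; have L0 : 0 < L by lra.
have /andP[e0 e1] := eps01.
set rho := 2 `^ (- (eps / 2)) : R.
have rho01 : 0 <= rho < 1.
  have c0 : 0 < eps / 2 by lra.
  rewrite powR_ge0 /= /rho powRN invf_lt1 ?powR_gt0 //.
  have := @gt0_ltr_powR R _ c0 1 2; rewrite powR1; apply; rewrite ?nnegrE //.
  by rewrite ltr1n.
have [rho0 rho1] := andP rho01.
have mtl q i : measurable_fun setT (fun w => tail q (W i w) ^+ 2).
  by apply: measurable_funX; apply: measurableT_comp => //; exact: measurable_tail.
have itl q i : itg P (fun w => tail q (W i w) ^+ 2).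
  have [i2 _] := noise_sqr i; apply: (itg_le (mtl q i) _ i2) => w.
  by rewrite ger0_norm ?sqr_ge0 // tail_sqr_le.
have [h|[law h]] := moments.
  exists (fun t => L * rho ^+ t * C1); split.
  - by move=> t; rewrite !mulr_ge0 ?exprn_ge0 // ltW.
  - move=> i t; have [i1 E1] := h i.
    have i2 := itgZ (L * rho ^+ t) i1.
    apply: (le_trans (le_Ex (itl _ i) i2 _)).
      by move=> w; exact: tail_sqr_le_powR.
    by rewrite ExZ //; apply: ler_wpM2l => //; rewrite mulr_ge0 ?exprn_ge0 // ltW.
  - move=> N; rewrite -mulr_suml -mulr_sumr.
    have /(ler_wpM2l (ltW C10)) g := geometric_sum_le N rho01.
    have /(ler_wpM2l (ltW L0)) g' := g.
    have : 0 <= L * (6 * C1 + 3) by rewrite mulr_ge0 ?ltW //; move: C10; lra.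
    by rewrite /tail_const -/rho; nra.
(* By equality of laws the tails of the variable at [ord0] bound all others. The sum over [t] can
   then be taken inside a single expectation. *)
exists (fun t => \int[P]_w (tail (2 ^+ t / L) (W ord0 w) ^+ 2)); split.
- by move=> t; apply: Ex_ge0 => w; exact: sqr_ge0.
- move=> i t; rewrite (@eq_law_Ex _ _ _ P (W i) (W ord0) (fun x => tail (2 ^+ t / L) x ^+ 2)) //.
  + by move=> A mA; exact: law.
  + by apply: measurable_funX; exact: measurable_tail.
  + by move=> x; exact: sqr_ge0.
- move=> N; rewrite -(@Ex_sum _ _ _ P N (fun t w => tail (2 ^+ t / L) (W ord0 w) ^+ 2)) //.
  have [i2 E2] := noise_sqr ord0; have [i1 E1] := h ord0.
  have i3 := itgD (itgZ (3 * L) i2) (itgZ 3 i1).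
  have i4 := @itg_sum _ _ _ P N (fun t w => tail (2 ^+ t / L) (W ord0 w) ^+ 2) (fun t _ => itl _ _).
  apply: (le_trans (le_Ex i4 i3 _)) => [w|]; first exact: tail_sqr_sum_le.
  rewrite ExD; [|exact: itgZ..].
  rewrite !ExZ //; have /(ler_wpM2l (ltW L0)) E2' := E2.
  have : 0 <= L * (C1 / (1 - rho)).
    by rewrite mulr_ge0 ?divr_ge0 ?ltW // subr_gt0.
  have : C1 <= L * C1 by rewrite ler_peMl // ltW.
  by rewrite /tail_const -/rho; lra.
Qed.

(* [Y_t] of the dyadic block [2^t <= m < 2^(t+1)] is bounded through the maximum over all [m < 2^(t+1)]. *)
Definition block_excess_sum (X : nat -> T -> R) (M : nat) (A : R) w : R :=
  \sum_(t < (trunc_log 2 M).+1)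
    Num.max (psup X (minn M (2 ^ t.+1)) w ^+ 2 / 2 ^+ t - A) 0.

Lemma noise_block_excess (e : nat -> 'I_n.+1) (M : nat) (L : R) : 1 <= L ->
  (forall i j, (i < M)%N -> (j < M)%N -> e i = e j -> i = j) ->
  let A := 32 * (2 + C1) ^+ 2 * L in
  itg P (block_excess_sum (fun i => W (e i)) M A) /\
  \int[P]_w block_excess_sum (fun i => W (e i)) M A w <=
    (trunc_log 2 M).+1%:R * (1024 * expR (- L)) + 32 * (tail_const eps C1 * L).
Proof.
move=> L1 einj A; have [g [g0 Wg gsum]] := noise_tail L1.
pose X i := W (e i).
pose F t w := Num.max (psup X (minn M (2 ^ t.+1)) w ^+ 2 / 2 ^+ t - A) 0.
have key t : itg P (F t) /\ \int[P]_w F t w <= 1024 * expR (- L) + 32 * g t.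
  (* The variance bound of the normalised noise is [v = 1 + C1]. *)
  rewrite /F /A (_ : 2 + C1 = 1 + (1 + C1)); last by ring.
  apply: (@block_excess _ _ _ P X M) => //.
  - by move=> i; exact: noise_measurable.
  - exact: noise_indep.
  - by move=> i _; exact: noise_mean.
  - by move=> i _; have [] := noise_sqr (e i).
  - by move=> i _; have [] := noise_sqr (e i).
  - by move=> i _; exact: Wg.
  - by move: C10; lra.
  - exact: geq_minl.
  - exact: geq_minr.
have iF t : itg P (F t) by have [] := key t.
split; first by apply: (@itg_sum _ _ _ P _ F) => t _.
rewrite (@Ex_sum _ _ _ P _ F) //.
apply: (@le_trans _ _ (\sum_(t < (trunc_log 2 M).+1) (1024 * expR (- L) + 32 * g t))).
  by apply: ler_sum => t _; have [] := key t.
rewrite big_split /= sumr_const card_ord -[X in X + _ <= _]mulr_natl lerD2l -mulr_sumr.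
by apply: ler_wpM2l; [|exact: gsum].
Qed.

End Noise.

(** * Risk bounds *)

Lemma ltn_subS_of (a b i : nat) : (i < b - a)%N -> (a <= b - i.+1 < b)%N.
Proof. lia. Qed.

Lemma subS_inj (a b i i' : nat) : (i < b - a)%N -> (i' < b - a)%N ->
  (b - i.+1 = b - i'.+1)%N -> i = i'.
Proof. lia. Qed.

(** * Monotonicity and jumps of piecewise constant vectors *)

Section ThetaUp.
Variables (R : realType) (n k : nat) (a : nat -> nat) (mu : nat -> R) (theta : 'I_n -> R).
Hypothesis a0 : a 0%N = 0%N.
Hypothesis ak : a k = n.
Hypothesis aS : forall j, (j < k)%N -> (a j <= a j.+1)%N.
Hypothesis muS : forall j, (1 <= j)%N -> (j < k)%N -> mu j <= mu j.+1.
Hypothesis thetaE : forall j (i : 'I_n), (1 <= j <= k)%N ->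
  (a j.-1 <= i)%N -> (i < a j)%N -> theta i = mu j.

Lemma theta_up_piece (i : 'I_n) :
  exists2 j, (j < k)%N & (a j <= i < a j.+1)%N /\ theta i = mu j.+1.
Proof.
have [|j jk /andP[h1 h2]] := piece_exists a0 (leqnn k) (_ : i < a k)%N; first by rewrite ak.
by exists j => //; split; [rewrite h1|exact: (thetaE (j := j.+1))].
Qed.

Lemma theta_up_mono (i i' : 'I_n) : (i <= i')%N -> theta i <= theta i'.
Proof.
move=> ii'.
have [j jk [/andP[h1 h2] ->]] := theta_up_piece i.
have [j' jk' [/andP[h1' h2'] ->]] := theta_up_piece i'.
have [jj'|j'j] := leqP j j'; last first.
  have := pieces_mono aS (_ : j'.+1 <= j <= k)%N; rewrite j'j (ltnW jk) => /(_ isT).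
  by lia.
elim: j' jj' jk' {h1' h2'} => [|m IH]; first by rewrite leqn0 => /eqP ->.
rewrite leq_eqVlt => /orP[/eqP -> //|jm mk].
by apply: (le_trans (IH jm (ltnW mk))); apply: muS.
Qed.

Lemma theta_up_jump (i i' : 'I_n) : i' = i.+1 :> nat -> theta i < theta i' ->
  exists2 j, (j < k)%N & a j = i'.
Proof.
move=> e lt; have [j jk [/andP[h1 h2] ej]] := theta_up_piece i.
have e' : a j.+1 = i'.
  apply/eqP; rewrite eqn_leq e h2 andbT leqNgt; apply/negP => h3.
  by move: lt; rewrite ej (thetaE (j := j.+1) (i := i')) ?ltxx //= e; lia.
(* The last breakpoint [a k = n] lies beyond every coordinate, so it cannot be a jump. *)
exists j.+1 => //; rewrite ltn_neqAle jk andbT; apply/eqP => jk'.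
by have := ltn_ord i'; rewrite -e' jk' ak ltnn.
Qed.

End ThetaUp.

Lemma Theta_up_cst (R : realType) (n k : nat) (c : R) : (0 < k)%N ->
  @Theta_up R n k (fun=> c).
Proof.
move=> k0; exists (fun j => if j is 0 then 0%N else n), (fun=> c).
by split=> //; [case: k k0|case].
Qed.

Lemma tail_const_ge0 (R : realType) (eps c : R) : 0 < eps < 1 -> 0 <= c ->
  0 <= tail_const eps c.
Proof.
move=> /andP[e0 _] c0; rewrite addr_ge0 //; last by lra.
rewrite divr_ge0 // subr_ge0 powRN invf_le1 ?powR_gt0 //.
rewrite -[leLHS](powRr0 (2 : R)); apply: ler_powR; last by lra.
by rewrite ler1n.
Qed.

Section RealBounds.
Variable R : realType.

Lemma ln_ge2 (u : R) : 16 <= u -> 2 <= ln u.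
Proof.
move=> u16; rewrite -[leLHS]expRK ler_ln ?posrE ?expR_gt0 //; last by lra.
apply: le_trans u16; have -> : expR 2 = expR (1 : R) ^+ 2 by rewrite -expRM_natl mulr1.
have h : expR (1 : R) <= 4 by have := @expR_le_quadratic R 1; rewrite normr1 => /(_ (lexx _)); lra.
by have := expR_ge0 (1 : R); nra.
Qed.

Lemma lnln_ge (u : R) : 16 <= u -> 2^-1 <= ln (ln u).
Proof.
move=> /ln_ge2 h; apply: (le_trans (@ln2_ge R)).
by rewrite ler_ln ?posrE //; lra.
Qed.

(** The logarithm lies below its tangent at [x]. The bound is affine in [M], so it can be summed
    over pieces of which only the total length is known; [x] will be the mean length. *)
Lemma trunc_log_le (M : nat) (x : R) : 1 <= x ->
  (trunc_log 2 M).+1%:R <= 2 * ln (16 * x) + 2 * (M%:R / x).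
Proof.
move=> x1; have x0 : 0 < x by lra.
have l16 : 2 <= ln (16 * x) by apply: ln_ge2; lra.
have [->|M0] := posnP M; first by rewrite mul0r trunc_log0 /= mulr1n; lra.
have MR : 0 < M%:R :> R by rewrite ltr0n.
have h1 : (trunc_log 2 M)%:R * ln 2 <= ln M%:R :> R.
  rewrite mulr_natl -lnXn // ler_ln ?posrE ?exprn_gt0 // -natrX ler_nat.
  exact: trunc_logP.
have h2 : (trunc_log 2 M)%:R * 2^-1 <= (trunc_log 2 M)%:R * ln 2 :> R.
  by apply: ler_wpM2l => //; exact: ln2_ge.
have h3 : ln M%:R <= ln x + (M%:R / x - 1).
  have Mx : 0 < M%:R / x by rewrite divr_gt0.
  rewrite -[M%:R in leLHS](divfK (lt0r_neq0 x0)) lnM ?posrE // addrC lerD2l.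
  have : ln (1 + (M%:R / x - 1)) <= M%:R / x - 1 by apply: le_ln1Dx; lra.
  by rewrite addrCA subrr addr0.
have h4 : ln x <= ln (16 * x) by rewrite ler_ln ?posrE //; lra.
by rewrite -natr1; lra.
Qed.

End RealBounds.

(** * From the pathwise bound to the expected risk *)

Section Risk.
Context (d : measure_display) (T : measurableType d) (R : realType) (P : probability T R).

Lemma expectation_le (f g : T -> R) (c : R) : measurable_fun setT f ->
  (forall w, 0 <= f w) -> (forall w, f w <= g w) -> itg P g -> \int[P]_w g w <= c ->
  ('E_P[f] <= c%:E)%E.
Proof.
move=> mf f0 fg ig gc; rewrite unlock.
have if_ : itg P f by apply: (itg_le mf _ ig) => w; rewrite ger0_norm.
rewrite -[leLHS]fineK; last exact: integrable_fin_num.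
by rewrite lee_fin; apply: le_trans gc; exact: le_Ex.
Qed.

(** Solving the hypothesis for [x] shows that [(E f - K) / 3] is a lower bound of [S], so no
    minimising competitor has to be chosen. *)
Lemma le_expectation_inf (f : T -> R) (S : set R) (K C : R) : (forall w, 0 <= f w) ->
  S !=set0 -> (forall x, S x -> 0 <= x) -> 3 <= C ->
  (forall x, S x -> ('E_P[f] <= (3 * x + K)%:E)%E) -> ('E_P[f] <= (C * inf S + K)%:E)%E.
Proof.
move=> f0 [x0 Sx0] S0 C3 h.
have E0 : (0 <= 'E_P[f])%E by apply: expectation_ge0.
have Efin : ('E_P[f])%E \is a fin_num.
  by rewrite ge0_fin_numE //; exact: le_lt_trans (h _ Sx0) (ltry _).
rewrite -(fineK Efin) lee_fin.
have i0 : 0 <= inf S by apply: lb_le_inf; [exists x0|].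
have : (fine ('E_P[f])%E - K) / 3 <= inf S.
  apply: lb_le_inf; first by exists x0.
  by move=> x /h; rewrite -(fineK Efin) lee_fin; lra.
have : 3 * inf S <= C * inf S by apply: ler_wpM2r.
lra.
Qed.

Lemma sqdist_ge0 n (x y : 'I_n -> R) : 0 <= sqdist x y.
Proof. by apply: sumr_ge0 => i _; exact: sqr_ge0. Qed.

Lemma measurable_sqdist n (X : T -> 'I_n -> R) (y : 'I_n -> R) :
  (forall i, measurable_fun setT (fun w => X w i)) ->
  measurable_fun setT (fun w => sqdist (X w) y).
Proof.
move=> mX; apply: measurable_sum => i; apply: measurable_funX.
exact: measurable_funB.
Qed.

(** Expanding the squares, least squares optimality leaves twice the noise term. The quarter of
    [|th' - th|^2] is at most half of [|th' - ts|^2 + |th - ts|^2], and the first half is absorbed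
    on the left. *)
Lemma lse_basic_ineq n (z ts th th' : 'I_n -> R) (c : R) :
  sqdist (fun j => ts j + z j) th' <= sqdist (fun j => ts j + z j) th ->
  2 * \sum_(i < n) z i * (th' i - th i) <= 4^-1 * sqdist th' th + c ->
  sqdist th' ts <= 3 * sqdist th ts + 2 * c.
Proof.
move=> h1 h2.
have e : sqdist th' ts = sqdist th ts + 2 * \sum_(i < n) z i * (th' i - th i)
   + (sqdist (fun j => ts j + z j) th' - sqdist (fun j => ts j + z j) th).
  rewrite /sqdist /sqnorm mulr_sumr -sumrB -!big_split; apply: eq_bigr => i _ /=; ring.
have : sqdist th' th <= 2 * sqdist th' ts + 2 * sqdist th ts.
  rewrite /sqdist /sqnorm !mulr_sumr -big_split; apply: ler_sum => i _ /=.
  by have := sqr_ge0 ((th' i - ts i) + (th i - ts i)); nra.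
lra.
Qed.

Section Fixed.
Variables (n : nat) (Z : 'I_n.+1 -> T -> R) (sigma eps C1 : R).
Hypothesis eps01 : 0 < eps < 1.
Hypothesis C10 : 0 < C1.
Hypothesis sigma0 : 0 < sigma.
Hypothesis condM : condition_M P Z sigma eps C1.
Variables (k : nat) (thetahat : ('I_n.+1 -> R) -> ('I_n.+1 -> R)).
Hypothesis lse : is_reduced_isotonic_LSE k thetahat.
Variable ts : 'I_n.+1 -> R.
Hypothesis mhat : forall i : 'I_n.+1,
  measurable_fun setT (fun w => thetahat (fun j => ts j + Z j w) i).

Let W i w := Z i w / sigma.
Let hat w := thetahat (fun j => ts j + Z j w).
Let risk w := sqdist (hat w) ts.

Let mrisk : measurable_fun setT risk.
Proof. exact: measurable_sqdist. Qed.

(** With a single piece the difference of two candidates is a constant vector, so only the total sum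
    of the noise matters and its variance suffices. No maximum is taken, hence no iterated
    logarithm. *)
Lemma risk_one th : k = 1%N -> Theta_up k th ->
  ('E_P[risk] <= (3 * sqdist th ts + 8 * (1 + C1) * sigma ^+ 2)%:E)%E.
Proof.
move=> k1 hth.
pose S w := psum (fun i => W (inord i)) n.+1 w.
have N0 : 0 < n.+1%:R :> R by rewrite ltr0n.
have inj i j : (i < n.+1)%N -> (j < n.+1)%N -> inord i = inord j :> 'I_n.+1 -> i = j.
  by move=> hi hj /(congr1 val); rewrite /= !inordK.
have [iS ES] := psum_L2 (fun i => noise_measurable condM (inord i))
  (noise_indep condM inj) (fun i _ => noise_mean condM (inord i))
  (fun i _ => proj1 (noise_sqr eps01 condM (inord i))) (leqnn n.+1).
have const (th' : 'I_n.+1 -> R) : Theta_up k th' -> exists c, forall i, th' i = c.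
  rewrite k1 => -[a [mu [e0 e1 _ _ h]]]; exists (mu 1%N) => i.
  by apply: h => //=; rewrite ?e0 // e1.
pose G w := 3 * sqdist th ts + 8 * sigma ^+ 2 / n.+1%:R * S w ^+ 2.
have iG : itg P G by apply: itgD; [exact: itg_cst|exact: itgZ].
apply: (@expectation_le _ G) => //.
- by move=> w; exact: sqdist_ge0.
- move=> w; have [hT hmin] := lse (fun j => ts j + Z j w).
  have [c hc] := const _ hT; have [c' hc'] := const _ hth.
  rewrite /G (_ : 8 * sigma ^+ 2 / n.+1%:R * S w ^+ 2 =
    2 * (4 * (sigma * S w) ^+ 2 / n.+1%:R)); last by field; rewrite gt_eqF.
  apply: (lse_basic_ineq (hmin _ hth)).
  have e1 : \sum_(i < n.+1) Z i w * (hat w i - th i) = (c - c') * (sigma * S w).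
    rewrite /S /psum !mulr_sumr; apply: eq_bigr => i _.
    by rewrite /hat hc hc' inord_val /W; field; rewrite gt_eqF.
  have e2 : sqdist (hat w) th = n.+1%:R * (c - c') ^+ 2.
    rewrite /sqdist /sqnorm (eq_bigr (fun=> (c - c') ^+ 2)); last by move=> i _; rewrite /hat hc hc'.
    by rewrite sumr_const card_ord mulr_natl.
  rewrite -/(hat w) e1 e2.
  set y := sigma * S w; set x := c - c'; set N := n.+1%:R in N0 *.
  (* Completing the square in [x]: [2 x y <= N x^2 / 4 + 4 y^2 / N]. *)
  have : 0 <= (N * x / 2 - 2 * y) ^+ 2 / N by rewrite divr_ge0 ?sqr_ge0 ?ltW.
  have -> : (N * x / 2 - 2 * y) ^+ 2 / N = 4^-1 * (N * x ^+ 2) - 2 * (x * y) + 4 * y ^+ 2 / N.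
    by field; rewrite gt_eqF.
  by rewrite addrAC subr_ge0.
- rewrite ExD ?Ex_cst ?ExZ //; [|exact: itg_cst|exact: itgZ].
  rewrite lerD2l ES.
  have s1 : \sum_(i < n.+1) \int[P]_w (Z (inord i) w / sigma) ^+ 2 <= (1 + C1) * n.+1%:R.
    rewrite mulr_natr -[n.+1 in leRHS]card_ord -sumr_const; apply: ler_sum => i _.
    by have [] := noise_sqr eps01 condM (inord i).
  have c0 : 0 <= 8 * sigma ^+ 2 / n.+1%:R by rewrite divr_ge0 ?mulr_ge0 ?sqr_ge0 ?ltW.
  apply: (le_trans (ler_wpM2l c0 s1)); rewrite le_eqVlt; apply/orP; left; apply/eqP.
  by field; rewrite gt_eqF.
Qed.

Lemma psum_sqr_le_block (X : nat -> T -> R) (M m : nat) w : (m < M)%N ->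
  (\sum_(i < m.+1) X i w) ^+ 2 <= 2 ^+ trunc_log 2 m.+1 *
    (psup X (minn M (2 ^ (trunc_log 2 m.+1).+1)) w ^+ 2 / 2 ^+ trunc_log 2 m.+1).
Proof.
move=> mM; rewrite mulrC divfK ?gt_eqF ?exprn_gt0 // -[leLHS]real_normK ?num_real //.
rewrite lerXn2r ?nnegrE //; first exact: psup_ge0.
apply: (rmax_ge (fun i => `|psum X i w|)).
by rewrite leq_min mM /= ltnW // trunc_log_ltn.
Qed.

(** The three summands are the cost of the level, [64 * 32 * 2], of the exponential excess,
    [16 * 2 * 1024 * 8], and of the tails, [16 * 2 * 64]. *)
Definition risk_const (e c : R) : R :=
  64 ^+ 2 * (2 + c) ^+ 2 + 512 ^+ 2 + 32 * 64 * tail_const e c.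

Section Pathwise.
Variables (th : 'I_n.+1 -> R) (a : nat -> nat) (mu : nat -> R) (B : R).
Hypothesis a0 : a 0%N = 0%N.
Hypothesis ak : a k = n.+1.
Hypothesis aS : forall j, (j < k)%N -> (a j <= a j.+1)%N.
Hypothesis thE : forall j (i : 'I_n.+1), (1 <= j <= k)%N ->
  (a j.-1 <= i)%N -> (i < a j)%N -> th i = mu j.
Hypothesis B0 : 0 <= B.

Let len j := (a j.+1 - a j)%N.
Definition left_noise (a : nat -> nat) j i := W (inord (a j + i)).
Definition right_noise (a : nat -> nat) j i := W (inord (a j.+1 - i.+1)).

Lemma piece_lt j i : (j < k)%N -> (i < a j.+1)%N -> (i < n.+1)%N.
Proof.
move=> jk h; rewrite -ak (leq_trans h) //; apply: (pieces_mono aS).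
by rewrite jk leqnn.
Qed.

Let th_const j i : (j < k)%N -> (a j <= i)%N -> (i < a j.+1)%N -> th (inord i) = mu j.+1.
Proof.
move=> jk h1 h2; have iN := piece_lt jk h2.
by apply: thE; rewrite /= ?inordK.
Qed.

(** Double counting: each of the [k] breakpoints equals [i + 1] for at most one [i]. *)
Lemma jump_count (b : nat -> nat) (N : nat) :
  (\sum_(i < N) [exists j : 'I_k, b j == i.+1] <= k)%N.
Proof.
apply: (@leq_trans (\sum_(i < N) \sum_(j < k) (b j == i.+1))).
  apply: leq_sum => i _; case: existsP => // -[j hj].
  by rewrite (bigD1 j) //= hj.
rewrite exchange_big /= -[X in (_ <= X)%N]card_ord -sum1_card; apply: leq_sum => j _.
case: (pickP (fun i : 'I_N => b j == i.+1)) => [i /eqP hi|h]; last first.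
  by rewrite big1 // => i _; rewrite h.
rewrite (bigD1 i) //= hi eqxx big1 // => i' ne; rewrite eqSS.
by rewrite eq_sym; move: ne; rewrite -val_eqE /= => /negbTE ->.
Qed.

Let z w i := W (inord i) w.
Let D w i := (hat w (inord i) - th (inord i)) / sigma.

(** The pieces are those of the competitor, on which [D] inherits monotonicity from the estimator.
    The flags mark the breakpoints [b] of the estimator, where alone it can increase. *)
Lemma inner_le_pathwise w :
  \sum_(i < a k) z w i * D w i <= 8^-1 * \sum_(i < a k) D w i ^+ 2 + 16 * B * k%:R
    + 4 * \sum_(j < k) (block_excess_sum (left_noise a j) (len j) B w
                       + block_excess_sum (right_noise a j) (len j) B w).
Proof.
have [[b [nu [b0 bk bS nuS hatE]]] _] := lse (fun j => ts j + Z j w).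
rewrite -/(hat w) in hatE.
have -> : \sum_(j < k) (block_excess_sum (left_noise a j) (len j) B w
    + block_excess_sum (right_noise a j) (len j) B w) =
  \sum_(j < k) \sum_(t < (trunc_log 2 (a j.+1 - a j)).+1)
    (Num.max (psup (left_noise a j) (minn (len j) (2 ^ t.+1)) w ^+ 2 / 2 ^+ t - B) 0 +
     Num.max (psup (right_noise a j) (minn (len j) (2 ^ t.+1)) w ^+ 2 / 2 ^+ t - B) 0).
  by apply: eq_bigr => j _; rewrite big_split.
apply: (@monotone_pieces_inner_le R (z w) (D w) a k B
  (fun i => [exists j : 'I_k, b j == i.+1])
  (fun j t => psup (left_noise a j) (minn (len j) (2 ^ t.+1)) w ^+ 2 / 2 ^+ t)
  (fun j t => psup (right_noise a j) (minn (len j) (2 ^ t.+1)) w ^+ 2 / 2 ^+ t)) => //.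
- move=> j i i' jk /andP[h1 h2] h3; rewrite /D ler_pM2r ?invr_gt0 //.
  rewrite (th_const jk h1 (leq_ltn_trans h2 h3)) (th_const jk (leq_trans h1 h2) h3) lerD2r.
  apply: (theta_up_mono b0 bk bS nuS hatE).
  by rewrite !inordK //; apply: (piece_lt jk) => //; exact: leq_ltn_trans h3.
- move=> j i jk h1 h2; rewrite /D ltr_pM2r ?invr_gt0 //.
  rewrite (th_const jk h1 (ltnW h2)) (th_const jk (leqW h1) h2) ltrD2r => lt.
  have iN := piece_lt jk h2.
  have [|l lk el] := theta_up_jump b0 bk hatE _ lt; first by rewrite !inordK // ltnW.
  by apply/existsP; exists (Ordinal lk); rewrite /= el inordK.
- exact: jump_count.
- by move=> j m jk mM; exact: (psum_sqr_le_block (left_noise a j)).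
- by move=> j m jk mM; exact: (psum_sqr_le_block (right_noise a j)).
Qed.

(** Twice the previous bound, rescaled by [sigma^2], has exactly the share [1/4] of the squared
    distance that the basic inequality can absorb. *)
Lemma risk_pathwise w : Theta_up k th -> risk w <= 3 * sqdist th ts +
  2 * (sigma ^+ 2 * (32 * B * k%:R +
    8 * \sum_(j < k) (block_excess_sum (left_noise a j) (len j) B w
                     + block_excess_sum (right_noise a j) (len j) B w))).
Proof.
move=> hth; have [_ hmin] := lse (fun j => ts j + Z j w).
apply: (lse_basic_ineq (hmin _ hth)); rewrite -/(hat w).
have e1 : \sum_(i < n.+1) Z i w * (hat w i - th i) =
    sigma ^+ 2 * \sum_(i < a k) z w i * D w i.
  rewrite ak mulr_sumr; apply: eq_bigr => i _.
  by rewrite /z /D /W inord_val; field; rewrite gt_eqF.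
have e2 : sqdist (hat w) th = sigma ^+ 2 * \sum_(i < a k) D w i ^+ 2.
  rewrite ak mulr_sumr; apply: eq_bigr => i _.
  by rewrite /D inord_val; field; rewrite gt_eqF.
have := ler_wpM2l (sqr_ge0 sigma) (inner_le_pathwise w).
rewrite e1 e2; move: (sigma ^+ 2) (\sum_(i < a k) z w i * D w i) (\sum_(i < a k) D w i ^+ 2)
  (\sum_(j < k) _) => s s1 s2 s3.
by move: B k%:R => B' k'; rewrite !mulrDr; lra.
Qed.

End Pathwise.

Section PieceCount.
Variable a : nat -> nat.
Hypothesis a0 : a 0%N = 0%N.
Hypothesis ak : a k = n.+1.
Hypothesis aS : forall j, (j < k)%N -> (a j <= a j.+1)%N.
Hypothesis k1 : (1 <= k <= n.+1)%N.

Let u : R := 16 * (n.+1%:R / k%:R).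
Let kR : 0 < k%:R :> R.
Proof. by rewrite ltr0n; case/andP: k1. Qed.
Let x1 : 1 <= n.+1%:R / k%:R :> R.
Proof. by rewrite ler_pdivlMr // mul1r ler_nat; case/andP: k1. Qed.
Lemma scale_ge16 : 16 <= u. Proof. by rewrite /u; move: x1; lra. Qed.

(** This counts the pairs of a piece and a scale. The linear terms of the tangent bound add up to
    [2 k] because the lengths sum to [n.+1], and [ln u >= 2] absorbs them. *)
Lemma block_count_le :
  \sum_(j < k) (trunc_log 2 (a j.+1 - a j)).+1%:R <= 4 * k%:R * ln u :> R.
Proof.
have lenk : \sum_(j < k) (a j.+1 - a j)%:R = n.+1%:R :> R.
  rewrite -natr_sum -ak; congr (_%:R).
  have := sum_pieces (V := nat) a0 aS (fun=> 1%N).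
  rewrite sum1_card card_ord => ->; apply: eq_bigr => j _.
  by rewrite sum1_card card_ord.
apply: (@le_trans _ _ (\sum_(j < k)
     (2 * ln u + 2 * ((a j.+1 - a j)%:R / (n.+1%:R / k%:R))))).
  by apply: ler_sum => j _; exact: trunc_log_le.
rewrite big_split /= sumr_const card_ord -mulr_sumr -mulr_suml lenk -[X in X + _]mulr_natl.
have -> : n.+1%:R / (n.+1%:R / k%:R) = k%:R :> R by field; rewrite !gt_eqF // ltr0n.
have := ler_wpM2l (ltW kR) (ln_ge2 scale_ge16).
by move: kR; move: (k%:R : R) (ln u) => k' l; lra.
Qed.

Lemma expRN_lnln_le : expR (- (2 * ln (ln u))) * ln u <= 1.
Proof.
have l2 := ln_ge2 scale_ge16; have ll := lnln_ge scale_ge16.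
rewrite -[X in _ * X <= _](lnK (_ : ln u \in Num.pos)) ?posrE; last by lra.
by rewrite -expRD -[leRHS]expR0 ler_expR; lra.
Qed.

(** With [L = 2 ln ln u], the factor [expR (- L)] cancels the [ln u] in the number of pairs. The
    remaining [4 k] is at most [8 k ln ln u] since [ln ln u >= 1/2]. *)
Lemma block_count_expRN_le :
  (\sum_(j < k) (trunc_log 2 (a j.+1 - a j)).+1%:R) * expR (- (2 * ln (ln u)))
    <= 8 * (k%:R * ln (ln u)).
Proof.
apply: (le_trans (ler_wpM2r (expR_ge0 _) block_count_le)).
rewrite (_ : 4 * k%:R * ln u * _ = 4 * k%:R * (expR (- (2 * ln (ln u))) * ln u)); last by ring.
have h1 : 4 * k%:R * (expR (- (2 * ln (ln u))) * ln u) <= 4 * k%:R * 1.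
  by apply: ler_wpM2l expRN_lnln_le; rewrite mulr_ge0 // ltW.
apply: (le_trans h1).
have := ler_wpM2l (ltW kR) (lnln_ge scale_ge16).
by move: k%:R (ln (ln u)) => k' l; lra.
Qed.

End PieceCount.

Lemma risk_many th : (1 <= k <= n.+1)%N -> Theta_up k th ->
  ('E_P[risk] <= (3 * sqdist th ts + risk_const eps C1 *
     (sigma ^+ 2 * k%:R * ln (ln (16 * n.+1%:R / k%:R))))%:E)%E.
Proof.
move=> kn hth; have [a [mu [a0 ak aS muS thE]]] := hth.
rewrite -[16 * _ / _]mulrA.
have := block_count_expRN_le a0 ak aS kn.
have := lnln_ge (scale_ge16 kn); set ell := ln (ln _) => ell2 count.
(* The factor [2] gives both [L >= 1], as [ell >= 1/2], and an exponential small enough for the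
   count of scales. *)
pose L := 2 * ell; have L1 : 1 <= L by rewrite /L; lra.
pose B := 32 * (2 + C1) ^+ 2 * L.
have B0 : 0 <= B.
  by apply: mulr_ge0; [apply: mulr_ge0 => //; exact: sqr_ge0|exact: le_trans ler01 L1].
pose len j := (a j.+1 - a j)%N.
pose El j := block_excess_sum (left_noise a j) (len j) B.
pose Er j := block_excess_sum (right_noise a j) (len j) B.
pose bnd j := (trunc_log 2 (len j)).+1%:R * (1024 * expR (- L)) + 32 * (tail_const eps C1 * L).
have hEl j : (j < k)%N -> itg P (El j) /\ \int[P]_w El j w <= bnd j.
  move=> jk; apply: (noise_block_excess eps01 C10 condM L1
    (e := fun i => inord (a j + i)) (M := len j) _) => i i' h h' /(congr1 val).
  rewrite /= !inordK; first exact: addnI.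
    by apply: (piece_lt ak aS jk); rewrite -ltn_subRL.
  by apply: (piece_lt ak aS jk); rewrite -ltn_subRL.
have hEr j : (j < k)%N -> itg P (Er j) /\ \int[P]_w Er j w <= bnd j.
  move=> jk; apply: (noise_block_excess eps01 C10 condM L1
    (e := fun i => inord (a j.+1 - i.+1)) (M := len j) _) => i i' h h' /(congr1 val).
  rewrite /= !inordK; first exact: subS_inj h h'.
    by apply: (piece_lt ak aS jk); have /andP[] := ltn_subS_of h'.
  by apply: (piece_lt ak aS jk); have /andP[] := ltn_subS_of h.
pose F j w := El j w + Er j w.
have hF j : (j < k)%N -> itg P (F j) /\ \int[P]_w F j w <= 2 * bnd j.
  move=> jk; have [i1 E1] := hEl j jk; have [i2 E2] := hEr j jk.
  split; first exact: itgD.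
  by rewrite ExD // mulr_natl mulr2n lerD.
pose H w := \sum_(j < k) F j w.
have iH : itg P H by apply: itg_sum => j /hF[].
(* An integrable majorant of the risk: the pathwise bound with its outer factor [2] distributed. *)
pose G w := 3 * sqdist th ts + sigma ^+ 2 * (64 * B * k%:R) + 16 * sigma ^+ 2 * H w.
have iG : itg P G by apply: itgD; [exact: itg_cst|exact: itgZ].
apply: (@expectation_le _ G) => //.
- by move=> w; exact: sqdist_ge0.
- move=> w; apply: (le_trans (risk_pathwise a0 ak aS thE B0 w hth)).
  rewrite /G -/(H w) le_eqVlt; apply/orP; left; apply/eqP.
  by ring.
- rewrite /G ExD; [|exact: itg_cst|exact: itgZ].
  rewrite Ex_cst ExZ //.
  have HE : \int[P]_w H w <= 2 * \sum_(j < k) bnd j.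
    rewrite /H Ex_sum; last by move=> j /hF[].
    by rewrite mulr_sumr; apply: ler_sum => j _; have [] := hF j (ltn_ord j).
  have bs : \sum_(j < k) bnd j =
      1024 * ((\sum_(j < k) (trunc_log 2 (a j.+1 - a j)).+1%:R) * expR (- (2 * ell)))
      + 64 * (tail_const eps C1 * (k%:R * ell)).
    rewrite /bnd big_split /= -mulr_suml sumr_const card_ord -[X in _ + X]mulr_natl /L.
    by move: (\sum_(j < k) _) (expR _) (tail_const _ _) => x y c; ring.
  move: HE; rewrite {}bs => HE.
  rewrite /risk_const /B /L -[leLHS]addrA lerD2l; move: HE count.
  move: (\int[P]_w H w) (_ * expR _) (tail_const eps C1) (sqr_ge0 sigma) => h x tc.
  move: (sigma ^+ 2) => s s0 HE count.
  have {HE}hh : h <= 2 * (1024 * (8 * (k%:R * ell)) + 64 * (tc * (k%:R * ell))) by lra.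
  have := ler_wpM2l s0 hh; move: (k%:R) => k' hs.
  (* The constant is split into the cost of the level and that of the expected excess. *)
  rewrite (_ : _ * (s * k' * ell) = s * (64 * (32 * (2 + C1) ^+ 2 * (2 * ell)) * k') +
    16 * (s * (2 * (1024 * (8 * (k' * ell)) + 64 * (tc * (k' * ell)))))); last by ring.
  by rewrite lerD2l -mulrA; apply: ler_wpM2l.
Qed.

End Fixed.
End Risk.

(** * The oracle inequality and the worst-case risk *)

Theorem mainTheorem1 (R : realType) (eps C1 : R) :
  0 < eps < 1 -> 0 < C1 ->
  exists C : R, 0 < C /\
  forall (n : nat) (d : measure_display) (T : measurableType d)
         (P : probability T R) (Z : 'I_n -> T -> R) (sigma : R),
    0 < sigma -> condition_M P Z sigma eps C1 ->
    forall (k : nat), (1 <= k <= n)%N ->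
    forall thetahat : ('I_n -> R) -> ('I_n -> R),
      is_reduced_isotonic_LSE k thetahat ->
      (forall thstar : 'I_n -> R, forall i : 'I_n,
         measurable_fun setT (fun w => thetahat (fun j => thstar j + Z j w) i)) ->
      (forall thstar : 'I_n -> R,
        ('E_P[(fun w => sqdist (thetahat (fun j => thstar j + Z j w)) thstar)%R]
         <= (C * (inf [set sqdist theta thstar | theta in @Theta_up R n k]
                  + sigma ^+ 2
                  + sigma ^+ 2 * k%:R * ln (ln (16 * n%:R / k%:R))
                    * (if (2 <= k)%N then 1 else 0)))%:E)%E)
      /\
      ((2 <= k)%N -> forall thstar : 'I_n -> R, Theta_up k thstar ->
        ('E_P[(fun w => sqdist (thetahat (fun j => thstar j + Z j w)) thstar)%R]
         <= (C * sigma ^+ 2 * k%:R * ln (ln (16 * n%:R / k%:R)))%:E)%E).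
Proof.
(* The summands serve the approximation error, the case [k = 1] and the case [k >= 2]. *)
move=> eps01 C10; pose C := 3 + 8 * (1 + C1) + risk_const eps C1.
have rc0 : 0 <= risk_const eps C1.
  have tc0 : 0 <= tail_const eps C1.
    have := tail_const_ge0 eps01 (ltW C10); lra.
  rewrite /risk_const; have := sqr_ge0 (2 + C1); nra.
have C3 : 3 <= C by rewrite /C; lra.
have C8 : 8 * (1 + C1) <= C by rewrite /C; lra.
have Crc : risk_const eps C1 <= C by rewrite /C; lra.
exists C; split; first by lra.
move=> [|n] d T P Z sigma sigma0 condM k kn thetahat lse mhat.
  by move: kn; rewrite leqn0 => /andP[/prednK <-].
set ell := ln (ln (16 * n.+1%:R / k%:R)).
have s0 := sqr_ge0 sigma.
have ell0 : 0 <= ell.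
  by rewrite /ell -mulrA (le_trans _ (lnln_ge (scale_ge16 R kn))).
have skl0 : 0 <= sigma ^+ 2 * k%:R * ell by apply: mulr_ge0 => //; exact: mulr_ge0.
split=> [ts|k2 ts hts]; last first.
  (* Here the true vector is its own competitor, so the approximation error vanishes. *)
  apply: (le_trans (risk_many eps01 C10 sigma0 condM lse (mhat ts) kn hts)).
  have -> : sqdist ts ts = 0 by apply: big1 => i _; rewrite subrr expr0n.
  have -> : C * sigma ^+ 2 * k%:R * ell = C * (sigma ^+ 2 * k%:R * ell) by rewrite !mulrA.
  by rewrite lee_fin mulr0 add0r; exact: ler_wpM2r.
set S := [set _ | _ in _].
pose K := if (2 <= k)%N then risk_const eps C1 * (sigma ^+ 2 * k%:R * ell)
          else 8 * (1 + C1) * sigma ^+ 2.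
have bound x : S x -> ('E_P[(fun w => sqdist (thetahat (fun j => ts j + Z j w)) ts)%R]
    <= (3 * x + K)%:E)%E.
  move=> [th hth <-]; rewrite /K; case: ifPn => k2; first exact: risk_many.
  apply: (risk_one eps01 sigma0 condM lse (mhat ts) _ hth).
  by move: kn k2; case: (k) => [|[|]].
have S0 : S !=set0.
  exists (sqdist (fun=> 0) ts), (fun=> 0) => //.
  by apply: Theta_up_cst; case/andP: kn.
have S_ge0 x : S x -> 0 <= x by move=> [th _ <-]; exact: sqdist_ge0.
have r0 w : 0 <= sqdist (thetahat (fun j => ts j + Z j w)) ts by exact: sqdist_ge0.
apply: (le_trans (le_expectation_inf r0 S0 S_ge0 C3 bound)).
(* For [k >= 2] the term in [sigma^2] is slack; for [k = 1] it carries the whole stochastic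
   error. *)
rewrite lee_fin !mulrDr -addrA lerD2l /K; have [k2|k2] := ifPn.
  have := ler_wpM2r skl0 Crc; have := mulr_ge0 (le_trans (ler0n _ 3) C3) s0.
  by rewrite mulr1; lra.
by rewrite !mulr0 addr0; exact: (ler_wpM2r s0 C8).
Qed.
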